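(* Let $\mathcal{B}\subseteq\mathcal{M}$ be a unital inclusion of type $\mathrm{II}_1$ factors. Then the following are equivalent: (i) $\mathcal{B}$ is regular in $\mathcal{M}$. (ii) $\mathcal{B}$ is groupoid regular in $\mathcal{M}$. (iii) $\mathcal{B}$ is unitary regular in $\mathcal{M}$.
   Context: For a unital inclusion of von Neumann algebras $\mathcal{B}\subseteq\mathcal{M}$ (i.e. $1_{\mathcal{B}}=1_{\mathcal{M}}$), put $\mathcal{N}_{\mathcal{M}}(\mathcal{B})=\{n\in\mathcal{M}: n\mathcal{B}n^*\cup n^*\mathcal{B}n\subseteq\mathcal{B}\}$ (normaliser), $\mathcal{GN}_{\mathcal{M}}(\mathcal{B})=\{v\in\mathcal{N}_{\mathcal{M}}(\mathcal{B}): vv^*v=v\}$ (groupoid normaliser), and $\mathcal{UN}_{\mathcal{M}}(\mathcal{B})=\{u\in\mathcal{M}\text{ unitary}: u\mathcal{B}u^*=\mathcal{B}\}$ (unitary normaliser). $W^*(S)$ denotes the von Neumann subalgebra of $\mathcal{M}$ generated by $S$. $\mathcal{B}$ is regular, groupoid regular, or unitary regular in $\mathcal{M}$ if $W^*(\mathcal{N}_{\mathcal{M}}(\mathcal{B}))=\mathcal{M}$, $W^*(\mathcal{GN}_{\mathcal{M}}(\mathcal{B}))=\mathcal{M}$, or $W^*(\mathcal{UN}_{\mathcal{M}}(\mathcal{B}))=\mathcal{M}$, respectively. *)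

(* Defs.v *)
From HB Require Import structures.
From mathcomp Require Import all_boot all_order all_algebra.
From mathcomp Require Import complex.
From mathcomp Require Import boolp classical_sets functions reals.
From mathcomp Require Import topology normedtype.

Set Implicit Arguments.
Unset Strict Implicit.
Unset Printing Implicit Defensive.

Import Order.TTheory GRing.Theory Num.Theory.
Import numFieldNormedType.Exports.

Local Open Scope classical_set_scope.
Local Open Scope ring_scope.
Local Open Scope complex_scope.

(* Complex Hilbert spaces: complete normed spaces whose norm comes from an
   inner product, which is linear in its first argument and conjugate-linear
   in the second one. *)
HB.mixin Record CompleteNormedModule_isHilbert (R : realType) (H : Type)
    of CompleteNormedModule R[i] H := {
  inner : {dot H for Num.conj} ;
  inner_norm : forall x : H, `|x| ^+ 2 = inner x x }.

#[short(type="hilbertType")]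
HB.structure Definition Hilbert (R : realType) :=
  {H of CompleteNormedModule R[i] H & CompleteNormedModule_isHilbert R H}.

Section BoundedOperators.
Context {R : realType} {H : hilbertType R}.
Implicit Types (S T : H -> H) (a : R[i]).

(* For a linear map between normed spaces, bounded is the same as continuous. *)
Definition bounded_op : {pred H -> H} :=
  [pred T : H -> H | `[< linear T /\ continuous T >]].

Lemma bounded_opP T : reflect (linear T /\ continuous T) (T \in bounded_op).
Proof. exact: asboolP. Qed.

Lemma bounded_op_submod : submod_closed bounded_op.
Proof.
split=> [|a S T /bounded_opP[lS cS] /bounded_opP[lT cT]]; apply/bounded_opP.
  split=> [b x y|x]; last exact: cst_continuous.
  by rewrite -[LHS]/(0 : H) scaler0 addr0.
split=> [b x y|x].
  rewrite -[LHS]/(a *: S (b *: x + y) + T (b *: x + y)).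
  rewrite -[RHS]/(b *: (a *: S x + T x) + (a *: S y + T y)).
  by rewrite lS lT !scalerDr !scalerA mulrC addrACA.
by apply: cvgD; [apply: cvgZr; exact: cS | exact: cT].
Qed.

HB.instance Definition _ :=
  GRing.isSubmodClosed.Build R[i] (H -> H) bounded_op bounded_op_submod.

End BoundedOperators.

(* B(H), with the pointwise vector space operations and composition as the
   product. It is only a [pzRingType], because 1 = 0 when H is the zero space. *)
Record boundedOp (R : realType) (H : hilbertType R) := BoundedOp {
  op_fun :> H -> H ;
  op_bounded : op_fun \in bounded_op }.

Notation "''B' ( H )" := (boundedOp H) (at level 0, format "''B' ( H )").

Section BoundedOperatorRing.
Context {R : realType} {H : hilbertType R}.

HB.instance Definition _ := [isSub for @op_fun R H].
HB.instance Definition _ := [Choice of 'B(H) by <:].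
HB.instance Definition _ := [SubChoice_isSubLmodule of 'B(H) by <:].

Implicit Types S T U : 'B(H).

Lemma op_ext S T : (forall x, S x = T x) -> S = T.
Proof. by move=> ST; apply/val_inj/funext. Qed.

Lemma id_bounded : (id : H -> H) \in bounded_op.
Proof. by apply/bounded_opP; split=> // x; exact: cvg_id. Qed.

Lemma comp_bounded S T : (S \o T) \in bounded_op.
Proof.
have /bounded_opP[lS cS] := op_bounded S.
have /bounded_opP[lT cT] := op_bounded T.
apply/bounded_opP; split=> [a x y|x]; first by rewrite /= lT lS.
by apply: continuous_comp; [exact: cT | exact: cS].
Qed.

Definition op_one : 'B(H) := BoundedOp id_bounded.
Definition op_mul S T : 'B(H) := BoundedOp (comp_bounded S T).

Lemma op_mulA : associative op_mul.
Proof. by move=> S T U; exact: op_ext. Qed.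

Lemma op_mul1 : left_id op_one op_mul.
Proof. by move=> S; exact: op_ext. Qed.

Lemma op_mulr1 : right_id op_one op_mul.
Proof. by move=> S; exact: op_ext. Qed.

Lemma op_mulDl : left_distributive op_mul +%R.
Proof. by move=> S T U; exact: op_ext. Qed.

Lemma op_mulDr : right_distributive op_mul +%R.
Proof.
move=> S T U; apply: op_ext => x.
have /bounded_opP[lS _] := op_bounded S.
rewrite -[LHS]/(S (T x + U x)) -[RHS]/(S (T x) + S (U x)).
by have := lS 1 (T x) (U x); rewrite !scale1r.
Qed.

HB.instance Definition _ := GRing.Zmodule_isPzRing.Build 'B(H)
  op_mulA op_mul1 op_mulr1 op_mulDl op_mulDr.

(* By the Riesz representation theorem every T has exactly one adjoint, so the
   default value of [xget] is never used. *)
Definition is_adjoint T S := forall x y : H, inner (T x) y = inner x (S y).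
Definition adj T : 'B(H) := xget 0 (is_adjoint T).

End BoundedOperatorRing.

Section VonNeumannAlgebras.
Context {R : realType} {H : hilbertType R}.
Implicit Types (A B M N S : set 'B(H)) (x y e f n u v : 'B(H)).

Definition commutant S : set 'B(H) := [set x | forall y, S y -> x * y = y * x].

(* All von Neumann algebras on H considered here contain the identity of H, so
   an inclusion of two of them is always unital. *)
Record is_vN M : Prop := IsVN {
  vN_one : M 1 ;
  vN_linear : forall (a : R[i]) x y, M x -> M y -> M (a *: x + y) ;
  vN_mul : forall x y, M x -> M y -> M (x * y) ;
  vN_adj : forall x, M x -> M (adj x) ;
  vN_bicommutant : commutant (commutant M) = M }.

Definition vN_generated M S : set 'B(H) :=
  [set x | forall N, is_vN N -> N `<=` M -> S `<=` N -> N x].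

Definition center M : set 'B(H) := M `&` commutant M.

Definition is_factor M : Prop :=
  [/\ is_vN M, (1 : 'B(H)) != 0 & center M = range (fun a : R[i] => a *: (1 : 'B(H)))].

Definition is_projection e : Prop := e * e = e /\ adj e = e.

(* The order of projections: the range of f is included in that of e. *)
Definition subprojection f e : Prop := e * f = f.

Definition mvn_equiv M e f : Prop :=
  exists v, [/\ M v, adj v * v = e & v * adj v = f].

Definition finite_projection M e : Prop :=
  [/\ M e, is_projection e &
    forall f, M f -> is_projection f -> subprojection f e ->
      mvn_equiv M e f -> f = e].

Definition abelian_projection M e : Prop :=
  [/\ M e, is_projection e &
    forall x y, M x -> M y ->
      (e * x * e) * (e * y * e) = (e * y * e) * (e * x * e)].

Definition type_II M : Prop :=
  (forall e, abelian_projection M e -> e = 0) /\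
  (forall z, center M z -> is_projection z -> z != 0 ->
    exists e, [/\ finite_projection M e, subprojection e z & e != 0]).

Definition type_II1 M : Prop := type_II M /\ finite_projection M 1.

Definition II1_factor M : Prop := is_factor M /\ type_II1 M.

Definition is_unitary u : Prop := u * adj u = 1 /\ adj u * u = 1.

Definition normaliser M B : set 'B(H) :=
  [set n | M n /\ [set n * b * adj n | b in B] `|`
                  [set adj n * b * n | b in B] `<=` B].

Definition groupoid_normaliser M B : set 'B(H) :=
  [set v | normaliser M B v /\ v * adj v * v = v].

Definition unitary_normaliser M B : set 'B(H) :=
  [set u | [/\ M u, is_unitary u & [set u * b * adj u | b in B] = B]].

Definition regular M B : Prop :=
  vN_generated M (normaliser M B) = M.

Definition groupoid_regular M B : Prop :=
  vN_generated M (groupoid_normaliser M B) = M.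

Definition unitary_regular M B : Prop :=
  vN_generated M (unitary_normaliser M B) = M.

End VonNeumannAlgebras.

(* Main.v *)
From HB Require Import structures.
From mathcomp Require Import all_boot all_order all_algebra complex.
From mathcomp Require Import boolp classical_sets functions reals.
From mathcomp Require Import topology normedtype.
From mathcomp Require Import ring lra.
Require Import Defs.

(** Unitary normalisers are groupoid normalisers and these are normalisers, so
    the content is that a von Neumann algebra N inside M which contains the
    unitary normalisers of B contains every normaliser n of B.

    First, N contains B, because B is generated by its own unitaries.  Next,
    n n^* and n^* n lie in B, and the polar decomposition n = v b has b in B
    and v a groupoid normaliser ([normaliser_polar]).  It remains to write v as
    u e with u a unitary normaliser and e a projection of B
    ([groupoid_normaliser_unitary]).

    To extend a nonzero v to a unitary, consider the partial isometries u of M that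
    extend v and for which u B u^*, u^* B u, u B v^* and u^* B v are contained
    in B.  By Zorn's lemma there is a maximal one.  If both u^* u and u u^* were
    different from 1, then, since any two nonzero projections of a factor have
    equivalent nonzero subprojections, there would be partial isometries w and
    y in B such that t = y v w^* is a nonzero partial isometry from a
    subprojection of 1 - u^* u to one of 1 - u u^*; and u + t would contradict
    maximality ([maximal_extension_full]).  The two conditions that involve v
    are what makes the cross terms u b t^* = (u (b w) v^* ) y^* fall into B.  So
    u is an isometry or a co-isometry, and it is unitary because M is finite.

    All analysis is obtained from two facts on Hilbert spaces, the existence of
    closest points in closed subspaces and the strong convergence of monotone
    families of operators ([monotone_limit]).  Polar decompositions are
    computed without functional calculus: for a contraction T the Newton
    iteration T |-> T (3 - T^* T) / 2 converges strongly to the partial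
    isometry of T ([newton_limit]).  All its terms are of the form T p with p a
    polynomial in T^* T, so that everything that is known of T passes to the
    limit: it gives at once the partial isometry of a normaliser, the Cayley-like
    unitaries that generate B, and the partial isometries that compare
    projections in a factor. *)

Set Implicit Arguments.
Unset Strict Implicit.
Unset Printing Implicit Defensive.

Import Order.TTheory GRing.Theory Num.Theory.
Import numFieldNormedType.Exports.

Local Open Scope classical_set_scope.
Local Open Scope ring_scope.
Local Open Scope complex_scope.

(** * The real inner product and closest points *)

Section RealInner.
Context {R : realType} {H : hilbertType R}.
Implicit Types (x y z : H) (a b : R[i]) (r s : R).

(** The real part of the inner product keeps all the information, because the
    imaginary part of the inner product of x and y is its value at x and 'i y
    ([innerE]); being real-valued, it gives access to suprema, infima and real
    arithmetic. *)
Definition rin x y : R := complex.Re (inner x y).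
Local Notation "''[' x , y ]" := (rin x y).
Local Notation "''[' x ]" := (rin x x).

Lemma rinDl x y z : '[x + y, z] = '[x, z] + '[y, z].
Proof. by rewrite /rin linearDl raddfD. Qed.
Lemma rinDr x y z : '[z, x + y] = '[z, x] + '[z, y].
Proof. by rewrite /rin linearDr raddfD. Qed.
Lemma rinNl x y : '[- x, y] = - '[x, y].
Proof. by rewrite /rin linearNl raddfN. Qed.
Lemma rinNr x y : '[x, - y] = - '[x, y].
Proof. by rewrite /rin linearNr raddfN. Qed.
Lemma rinBl x y z : '[x - y, z] = '[x, z] - '[y, z].
Proof. by rewrite rinDl rinNl. Qed.
Lemma rinBr x y z : '[z, x - y] = '[z, x] - '[z, y].
Proof. by rewrite rinDr rinNr. Qed.
Lemma rin0l x : '[0, x] = 0.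
Proof. by rewrite /rin linear0l. Qed.
Lemma rin0r x : '[x, 0] = 0.
Proof. by rewrite /rin linear0r. Qed.
Lemma rinZl r x y : '[r%:C *: x, y] = r * '[x, y].
Proof.
by rewrite /rin linearZl_LR /=; case: (inner x y) => u v /=; rewrite mul0r subr0.
Qed.

Lemma innerDr x y z : inner z (x + y) = inner z x + inner z y.
Proof. exact: linearDr. Qed.
Lemma innerBl x y z : inner (x - y) z = inner x z - inner y z.
Proof. exact: linearBl. Qed.
Lemma innerZl a x y : inner (a *: x) y = a * inner x y.
Proof. exact: linearZl_LR. Qed.
Lemma innerZr a x y : inner x (a *: y) = Num.conj a * inner x y.
Proof. exact: linearZr_LR. Qed.
Lemma inner0l x : inner 0 x = 0.
Proof. exact: linear0l. Qed.
Lemma innerC x y : inner x y = Num.conj (inner y x).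
Proof. by rewrite hermC mul1r. Qed.

Lemma rinC x y : '[x, y] = '[y, x].
Proof. by rewrite /rin innerC; case: (inner y x). Qed.
Lemma rinZr r x y : '[x, r%:C *: y] = r * '[x, y].
Proof. by rewrite rinC rinZl rinC. Qed.

Lemma rini x y : '[x, 'i *: y] = complex.Im (inner x y).
Proof.
rewrite /rin linearZr_LR /=; case: (inner x y) => u v /=.
by rewrite mul0r mulN1r sub0r opprK.
Qed.

Lemma innerE x y : inner x y = '[x, y] +i* '[x, 'i *: y].
Proof. by rewrite rini /rin; case: (inner x y). Qed.

Lemma innerxx x : inner x x = ('[x])%:C.
Proof.
rewrite /rin; have := dnorm_ge0 inner x; case: (inner x x) => u v /=.
by rewrite lecE /= => /andP[/eqP -> _].
Qed.

Lemma rin_ge0 x : 0 <= '[x].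
Proof. by have := dnorm_ge0 inner x; rewrite innerxx lecR. Qed.

Lemma rin_eq0 x : '[x] = 0 -> x = 0.
Proof.
move=> x0; have := innerxx x; rewrite x0 => /eqP; rewrite dnorm_eq0.
by move/eqP.
Qed.

Lemma rin_gt0 x : x != 0 -> 0 < '[x].
Proof.
move=> x0; rewrite lt_neqAle rin_ge0 andbT eq_sym.
by apply: contra x0 => /eqP/rin_eq0 ->.
Qed.

Lemma rin_ext x y : (forall z, '[x, z] = '[y, z]) -> x = y.
Proof.
by move=> e; apply/eqP; rewrite -subr_eq0; apply/eqP/rin_eq0; rewrite rinBl e subrr.
Qed.

Lemma rinDD x y : '[x + y] = '[x] + 2 * '[x, y] + '[y].
Proof. rewrite rinDl !rinDr (rinC y x); ring. Qed.
Lemma rinBB x y : '[x - y] = '[x] - 2 * '[x, y] + '[y].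
Proof. rewrite rinBl !rinBr (rinC y x); ring. Qed.

(** Nonnegativity of the square of x - u y, where u y is the projection of x on y. *)
Lemma rin_CauchySchwarz x y : '[x, y] ^+ 2 <= '[x] * '[y].
Proof.
have [->|y0] := eqVneq y 0; first by rewrite !rin0r expr0n mulr0.
have ry := rin_gt0 y0.
have := rin_ge0 (x - ('[x, y] / '[y])%:C *: y).
rewrite rinBB !(rinZl, rinZr).
have : '[x, y] / '[y] * '[y] = '[x, y] by rewrite divfK ?gt_eqF.
move: ('[x, y] / '[y]) => u <- h.
have := mulr_ge0 h (ltW ry); nra.
Qed.

(** The norm of H takes values in R[i]; this is its real counterpart ([normE]). *)
Definition nrm x : R := Num.sqrt '[x].

Lemma nrm_ge0 x : 0 <= nrm x. Proof. exact: sqrtr_ge0. Qed.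
Lemma nrm_sq x : nrm x ^+ 2 = '[x].
Proof. by rewrite sqr_sqrtr// rin_ge0. Qed.

Lemma normE x : `|x| = (nrm x)%:C.
Proof.
apply/eqP; rewrite -(@eqrXn2 _ 2)//; last by rewrite lecR nrm_ge0.
by rewrite inner_norm innerxx -nrm_sq rmorphXn.
Qed.

Lemma CSnrm x y : `|'[x, y]| <= nrm x * nrm y.
Proof.
rewrite -ler_sqr ?nnegrE ?mulr_ge0 ?nrm_ge0//.
by rewrite exprMn !nrm_sq real_normK ?num_real ?rin_CauchySchwarz.
Qed.

Lemma cvg_nrmP {T : Type} {F : set_system T} {FF : Filter F} (f : T -> H) x :
  f @ F --> x <-> nrm (f t - x) @[t --> F] --> (0 : R).
Proof.
split=> [|] /cvgrPdist_lt h; apply/cvgrPdist_lt.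
  move=> e e0; have := h e%:C; rewrite ltcR => /(_ e0).
  apply: filterS => t; rewrite sub0r normrN ger0_norm ?nrm_ge0// distrC normE.
  by rewrite ltcR.
move=> e; rewrite ltcE => /andP[/eqP ei e0]; have := h _ e0.
apply: filterS => t; rewrite sub0r normrN ger0_norm ?nrm_ge0// distrC normE.
by rewrite ltcE /= ei eqxx.
Qed.

Lemma cvg_rin {T : Type} {F : set_system T} {FF : Filter F} (f g : T -> H) x y :
  f @ F --> x -> g @ F --> y -> '[f t, g t] @[t --> F] --> '[x, y].
Proof.
move=> /cvg_nrmP fx /cvg_nrmP gy; apply/cvgrPdist_lt => e e0.
have : (nrm (f t - x) * nrm (g t - y) + nrm (f t - x) * nrm y
   + nrm x * nrm (g t - y)) @[t --> F] --> (0 * 0 + 0 * nrm y + nrm x * 0 : R).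
  apply: cvgD; first apply: cvgD.
  - exact: cvgM.
  - by apply: cvgM => //; exact: cvg_cst.
  - by apply: cvgM => //; exact: cvg_cst.
rewrite !(mul0r, mulr0, addr0) => /cvgrPdist_lt/(_ e e0); apply: filterS => t.
rewrite sub0r normrN ger0_norm; last first.
  by rewrite !addr_ge0 ?mulr_ge0 ?nrm_ge0.
apply: le_lt_trans; rewrite distrC.
have -> : '[f t, g t] - '[x, y]
  = '[f t - x, g t - y] + '[f t - x, y] + '[x, g t - y].
  rewrite !(rinBl, rinBr); ring.
rewrite (le_trans (ler_normD _ _))// lerD ?CSnrm//.
by rewrite (le_trans (ler_normD _ _))// lerD ?CSnrm.
Qed.

Lemma cvg_hilbert_unique {T : Type} {F : set_system T} {FF : ProperFilter F}
    (f : T -> H) x y :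
  f @ F --> x -> f @ F --> y -> x = y.
Proof. by move=> fx fy; exact: (@norm_cvg_unique _ _ (f @ F)). Qed.

(** Completeness of H, in a form that suits estimates of squared norms. *)
Lemma cauchy_cvg_nrm {T : Type} {F : set_system T} {FF : ProperFilter F} (f : T -> H) :
  (forall e : R, 0 < e -> exists x, \forall t \near F, '[f t - x] < e) ->
  exists x, f @ F --> x.
Proof.
move=> h; apply/cvg_ex; apply: (@cauchy_cvg _ (f @ F)); apply/cauchy_exP => e.
rewrite ltcE => /andP[/eqP ei e0].
have /h[x hx] : 0 < complex.Re e ^+ 2 by rewrite exprn_gt0.
exists x; apply: filterS hx => t /= ht.
rewrite -ball_normE /ball_ /= distrC normE ltcE /= ei eqxx /=.
by rewrite -ltr_sqr ?nnegrE ?nrm_ge0 ?(ltW e0)// nrm_sq.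
Qed.

Definition linear_subset (D : set H) := D 0 /\ forall a x y, D x -> D y -> D (a *: x + y).

(** By the parallelogram identity the points of D that almost realise the
    distance from x to D form a Cauchy filter; the point p where this filter
    converges realises the distance, and x - p is then orthogonal to D, since
    no p + t y with y in D is closer to x. *)
Lemma orthogonal_decomposition (D : set H) x : linear_subset D -> closed D ->
  exists2 p, D p & forall y, D y -> '[x - p, y] = 0.
Proof.
move=> [D0 DL] Dc.
(* the squared distances from x to the points of D *)
pose V : set R := [set '[x - y] | y in D].
have Vinf : has_inf V.
  by split; [exists '[x - 0]; exists 0|exists 0 => _ [y _ <-]; exact: rin_ge0].
pose d := inf V.
have dle y : D y -> d <= '[x - y].
  by move=> Dy; apply: ge_inf; [exact: Vinf.2 | exists y].
pose F := filter_from [set e : R | 0 < e] (fun e => [set y | D y /\ '[x - y] < d + e]).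
have FF : ProperFilter F.
  apply: filter_from_proper.
    apply: filter_from_filter; first by exists 1 => /=.
    move=> e1 e2 /= e10 e20; exists (Num.min e1 e2); first by rewrite /= lt_min e10.
    move=> y /= [Dy]; rewrite -ltrBDl lt_min !ltrBDl => /andP[? ?].
    by split; split.
  move=> e /= e0; have := inf_adherent e0 Vinf; rewrite -/d => -[_ [y Dy <-] he].
  by exists y.
have DM y z : D y -> D z -> D ((2^-1 : R)%:C *: (y + z)).
  move=> Dy Dz. rewrite -[_ *: _]addr0; apply: (DL) => //.
  by rewrite -[y]scale1r; apply: (DL).
have [|p Fp] := @cauchy_cvg_nrm _ _ FF id.
  move=> e e0; have e4 : 0 < e / 4 by rewrite divr_gt0.
  have := inf_adherent e4 Vinf; rewrite -/d => -[_ [z Dz <-] he].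
  exists z; exists (e / 4) => //= y [Dy hy].
  have := dle _ (DM y z Dy Dz).
  have -> : x - (2^-1 : R)%:C *: (y + z)
     = (2^-1 : R)%:C *: ((x - y) + (x - z)).
    have e2 : (2^-1 : R)%:C + (2^-1 : R)%:C = 1 :> R[i].
      by rewrite -raddfD /= -[RHS](rmorph1 (real_complex R)); congr (_%:C); field.
    by rewrite !(scalerDr, scalerBr, scalerN) addrACA -scalerDl e2 scale1r opprD.
  have -> : y - z = (x - z) - (x - y) by rewrite opprB [RHS]addrC addrA subrK.
  rewrite rinZl rinZr rinDD (rinBB (x - z)) (rinC (x - z) (x - y)).
  lra.
have Dp : D p by apply: (closed_cvg _ Dc _ _ Fp); exists 1 => //= y [].
exists p => //.
have pd : '[x - p] <= d.
  have c : '[x - y] @[y --> F] --> '[x - p].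
    by apply: cvg_rin; apply: cvgB => //; exact: cvg_cst.
  apply/ler_addgt0Pr => e e0; apply: (closed_cvg (fun r => r <= d + e) _ _ _ c).
    exact: closed_le.
  by exists e => //= y [_ /ltW].
move=> y Dy; have [->|y0] := eqVneq y 0; first by rewrite rin0r.
pose t := '[x - p, y] / '[y].
have Dt : D (t%:C *: y + p) by exact: DL.
have := le_trans pd (dle _ Dt).
rewrite opprD addrCA addrC (rinBB (x - p)) !(rinZr, rinZl).
have q0 := rin_gt0 y0.
have : t * '[y] = '[x - p, y] by rewrite /t divfK ?gt_eqF.
move: t {Dt} => t <- h; have : t ^+ 2 * '[y] <= 0 by nra.
rewrite pmulr_lle0// => t0; have : t ^+ 2 = 0.
  by apply/eqP; rewrite eq_le t0 sqr_ge0.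
by move/eqP; rewrite sqrf_eq0 => /eqP ->; rewrite mul0r.
Qed.

End RealInner.

(** * Bounded operators and their adjoints *)

Section Operators.
Context {R : realType} {H : hilbertType R}.
Implicit Types (x y z : H) (a b : R[i]) (r s : R) (S T U : 'B(H)).
Local Notation "''[' x , y ]" := (rin x y).
Local Notation "''[' x ]" := (rin x x).

Lemma opDE S T x : (S + T) x = S x + T x. Proof. by []. Qed.
Lemma opNE T x : (- T) x = - T x. Proof. by []. Qed.
Lemma opZE a T x : (a *: T) x = a *: T x. Proof. by []. Qed.
Lemma opME S T x : (S * T) x = S (T x). Proof. by []. Qed.
Lemma op1E x : (1 : 'B(H)) x = x. Proof. by []. Qed.
Lemma op0E x : (0 : 'B(H)) x = 0. Proof. by []. Qed.
Definition opE := (opDE, opNE, opZE, opME, op1E, op0E).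

Lemma op_linear T : linear T.
Proof. by have /bounded_opP[] := op_bounded T. Qed.
Lemma op_continuous T : continuous T.
Proof. by have /bounded_opP[] := op_bounded T. Qed.

HB.instance Definition _ T := GRing.isLinear.Build R[i] H H *:%R T (op_linear T).

Lemma opZ T a x : T (a *: x) = a *: T x. Proof. exact: linearZ. Qed.
Lemma opD T x y : T (x + y) = T x + T y. Proof. exact: linearD. Qed.
Lemma op0 T : T 0 = 0. Proof. exact: linear0. Qed.
Lemma opN T x : T (- x) = - T x. Proof. exact: linearN. Qed.
Lemma opB T x y : T (x - y) = T x - T y. Proof. exact: linearB. Qed.

Lemma op_scalel a S T : (a *: S) * T = a *: (S * T).
Proof. exact: op_ext. Qed.
Lemma op_scaler a S T : S * (a *: T) = a *: (S * T).
Proof. by apply: op_ext => x; rewrite !opE opZ. Qed.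

Lemma op_bound T : exists2 c : R, 0 < c & forall x, nrm (T x) <= c * nrm x.
Proof.
have : bounded_near T (nbhs (0 : H)).
  by apply: continuous_linear_bounded; exact: op_continuous.
move/linear_boundedP/pinfty_ex_gt0 => [c c0 h].
move: c0; rewrite ltcE => /andP[/eqP ci c0]; exists (complex.Re c) => // x.
have := h x; rewrite !normE; case: c ci {c0 h} => u v /= ->.
by rewrite -[_ +i* _]/(u%:C) -rmorphM lecR.
Qed.

(** This is how operators obtained by pointwise choice enter 'B(H). *)
Lemma op_of_bound (f : H -> H) c :
  linear f -> (forall x, nrm (f x) <= c * nrm x) -> exists T, forall x, T x = f x.
Proof.
move=> lf bf.
suff fb : f \in bounded_op by exists (BoundedOp fb).
apply/bounded_opP; split=> // x.
have f_sub y z : f y - f z = f (y - z).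
  by have := lf (-1) z y; rewrite !scaleN1r addrC => <-; rewrite addrC.
apply/cvg_nrmP; apply/cvgrPdist_lt => e e0.
have c1 : 0 < `|c| + 1 by rewrite ltr_wpDl.
have /cvg_nrmP/cvgrPdist_lt/(_ (e / (`|c| + 1))) : (id : H -> H) @ x --> x.
  exact: cvg_id.
rewrite divr_gt0// => /(_ isT); apply: filterS => y /=.
rewrite !sub0r !normrN !(ger0_norm (nrm_ge0 _)) f_sub ltr_pdivlMr// => h.
apply: le_lt_trans h; apply: le_trans (bf _) _; rewrite mulrC.
by rewrite ler_wpM2l ?nrm_ge0// (le_trans (ler_norm _))// lerDl.
Qed.

Lemma closed_ker T : closed [set x | T x = 0].
Proof.
rewrite (_ : mkset _ = T @^-1` [set 0])//; apply: closed_comp.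
  by move=> x _; exact: op_continuous.
exact/accessible_closed_set1/hausdorff_accessible/norm_hausdorff.
Qed.

Lemma orthogonal_inner (D : set H) x : linear_subset D ->
  (forall y, D y -> '[x, y] = 0) -> forall y, D y -> inner x y = 0.
Proof.
move=> [D0 DL] h y Dy; rewrite innerE !h//.
by rewrite -['i *: y]addr0; exact: DL.
Qed.

(** Riesz's representation of the functional f x = inner (T x) y: if f is not
    zero, the orthogonal complement of its kernel contains some w with f w <> 0,
    and every x differs from (f x / f w) w by an element of the kernel. *)
Lemma adjoint_vector T y : exists z, forall x, '[T x, y] = '[x, z].
Proof.
pose D := [set x | inner (T x) y = 0].
have sD : linear_subset D.
  split; first by rewrite /D /= op0 inner0l.
  by move=> a u v; rewrite /D /= op_linear linearPl /= => -> ->; rewrite mulr0 addr0.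
have Dc : closed D.
  have cl z : closed [set x | '[T x, z] = 0].
    rewrite (_ : mkset _ = (fun x => '[T x, z]) @^-1` [set 0])//.
    apply: closed_comp; last first.
      exact/accessible_closed_set1/hausdorff_accessible/norm_hausdorff.
    by move=> x _; apply: cvg_rin; [exact: op_continuous|exact: cvg_cst].
  rewrite (_ : D = [set x | '[T x, y] = 0] `&` [set x | '[T x, 'i *: y] = 0]).
    exact: closedI.
  apply/seteqP; split=> x; rewrite /D /= innerE; last by case=> -> ->.
  by case=> -> ->.
have [Dall|] := pselect (forall x, D x).
  by exists 0 => x; rewrite rin0r /rin Dall.
move=> /existsNP[x0 nx0].
have [p Dp /(orthogonal_inner sD) op] := orthogonal_decomposition x0 sD Dc.
pose w := x0 - p.
have fw : inner (T w) y != 0.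
  have Tp : inner (T p) y = 0 := Dp.
  by rewrite opB innerBl Tp subr0; exact/eqP.
have w0 : w != 0 by apply: contra fw => /eqP ->; rewrite op0 inner0l.
exists (Num.conj (inner (T w) y / inner w w) *: w) => x.
rewrite {2}/rin innerZr /= conjCK.
have : D (x - (inner (T x) y / inner (T w) y) *: w).
  by rewrite /D /= opB opZ innerBl innerZl /= divfK ?subrr.
move=> /op /eqP; rewrite innerC conjC_eq0 innerBl innerZl /= subr_eq0 => /eqP ->.
by rewrite mulrCA divfK ?dnorm_eq0// divfK.
Qed.

(** The vectors given by [adjoint_vector] depend linearly and boundedly on y. *)
Lemma adjoint_exists T : exists S, is_adjoint T S.
Proof.
have [f hf] := choice (adjoint_vector T).
have hi u v : inner (T u) v = inner u (f v).
  rewrite (innerC (T u)) (innerC u); congr (Num.conj _).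
  by rewrite !innerE -opZ (rinC v) hf -(rinC (f v)) (rinC v) hf (rinC _ (f v)).
have [c c0 hc] := op_bound T.
have lf : linear f.
  move=> a x y; apply: rin_ext => z; rewrite rinC (rinC _ z) /rin -hi.
  by rewrite !innerDr !innerZr /= !hi.
have bf x : nrm (f x) <= c * nrm x.
  have [->|fx] := eqVneq (f x) 0.
    by rewrite /nrm rin0l sqrtr0 mulr_ge0 ?nrm_ge0// ltW.
  have f0 : 0 < nrm (f x) by rewrite sqrtr_gt0 rin_gt0.
  rewrite -(ler_pM2l f0) -expr2 nrm_sq -hf (le_trans (ler_norm _))//.
  rewrite (le_trans (CSnrm _ _))// mulrA [_ * c]mulrC.
  by rewrite ler_wpM2r ?nrm_ge0.
have [S hS] := op_of_bound lf bf.
by exists S => x y; rewrite hS hi.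
Qed.

Lemma adjP T : is_adjoint T (adj T).
Proof. by rewrite /adj; case: xgetP => [S _ //|h]; have [S /h] := adjoint_exists T. Qed.

Lemma rin_adj T x y : '[T x, y] = '[x, adj T y].
Proof. by rewrite /rin adjP. Qed.

Lemma rin_adjl T x y : '[adj T x, y] = '[x, T y].
Proof. by rewrite rinC -rin_adj rinC. Qed.

Lemma adj_unique S T : (forall x y, '[T x, y] = '[x, S y]) -> adj T = S.
Proof.
move=> h; apply: op_ext => y; apply: rin_ext => x.
by rewrite rinC -rin_adj h rinC.
Qed.

Lemma adjopK T : adj (adj T) = T.
Proof. by apply: adj_unique => x y; rewrite rin_adjl. Qed.
Lemma adjopM S T : adj (S * T) = adj T * adj S.
Proof. by apply: adj_unique => x y; rewrite !opE !rin_adj. Qed.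
Lemma adjopD S T : adj (S + T) = adj S + adj T.
Proof. by apply: adj_unique => x y; rewrite !opE rinDl rinDr !rin_adj. Qed.
Lemma adjopN T : adj (- T) = - adj T.
Proof. by apply: adj_unique => x y; rewrite !opE rinNl rinNr !rin_adj. Qed.
Lemma adjopB S T : adj (S - T) = adj S - adj T.
Proof. by rewrite adjopD adjopN. Qed.
Lemma adjop1 : adj (1 : 'B(H)) = 1.
Proof. exact: adj_unique. Qed.
Lemma adjop0 : adj (0 : 'B(H)) = 0.
Proof. by apply: adj_unique => x y; rewrite !op0E rin0l rin0r. Qed.
Lemma adjopZ a T : adj (a *: T) = Num.conj a *: adj T.
Proof.
apply: adj_unique => x y; rewrite !opE /rin innerZl innerZr /= conjCK.
by rewrite adjP.
Qed.

Lemma adjopZr r T : adj (r%:C *: T) = r%:C *: adj T.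
Proof. by apply: adj_unique => x y; rewrite !opE rinZl rinZr rin_adj. Qed.

(** Since the inner product of T^* T x and x is the square of the norm of T x. *)
Lemma adj_mul_eq0 T : adj T * T = 0 -> T = 0.
Proof.
move=> h; apply: op_ext => x; apply: rin_eq0.
by rewrite rin_adj -opME h rin0r.
Qed.

End Operators.

(** * Strong limits of operators *)

Section StrongLimits.
Context {R : realType} {H : hilbertType R}.
Implicit Types (x y z : H) (a b : R[i]) (r s : R) (S T U L : 'B(H)).
Local Notation "''[' x , y ]" := (rin x y).
Local Notation "''[' x ]" := (rin x x).

Definition nonexpansive T := forall x, '[T x] <= '[x].

Lemma nonexpansive_adj T : nonexpansive T -> nonexpansive (adj T).
Proof.
move=> cT x; have [->|x0] := eqVneq (adj T x) 0; first by rewrite rin0r rin_ge0.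
have := rin_CauchySchwarz (T (adj T x)) x.
rewrite rin_adj => h; have p := rin_gt0 x0.
rewrite -(ler_pM2l p) -expr2 (le_trans h)// ler_wpM2r ?rin_ge0//.
Qed.

Section Filtered.
Context {I : Type} {F : set_system I} {FF : ProperFilter F}.
Implicit Types u v : I -> 'B(H).

Definition strong_limit (F : set_system I) u L := forall x, u i x @[i --> F] --> L x.

Lemma strong_limit_unique u L L' : strong_limit F u L -> strong_limit F u L' -> L = L'.
Proof. by move=> h h'; apply: op_ext => x; apply: cvg_hilbert_unique (h x) (h' x). Qed.

Lemma strong_limit_cst T : strong_limit F (fun=> T) T.
Proof. by move=> x; exact: cvg_cst. Qed.

Lemma strong_limitD u v L L' : strong_limit F u L -> strong_limit F v L' ->
  strong_limit F (fun i => u i + v i) (L + L').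
Proof. by move=> h h' x; apply: cvgD; [exact: h|exact: h']. Qed.

Lemma strong_limitB u v L L' : strong_limit F u L -> strong_limit F v L' ->
  strong_limit F (fun i => u i - v i) (L - L').
Proof. by move=> h h' x; apply: cvgB; [exact: h|exact: h']. Qed.

Lemma strong_limitZ u L a : strong_limit F u L ->
  strong_limit F (fun i => a *: u i) (a *: L).
Proof. by move=> h x; apply: cvgZl_tmp; exact: h. Qed.

Lemma strong_limitMl u L T : strong_limit F u L ->
  strong_limit F (fun i => T * u i) (T * L).
Proof.
by move=> h x; exact: cvg_comp (h x) (@op_continuous _ _ T (L x)).
Qed.

(** Multiplication is not jointly strongly continuous; it becomes so when its left
    factors are uniformly bounded. *)
Lemma strong_limitM u v L L' : (forall i, nonexpansive (u i)) ->
  strong_limit F u L -> strong_limit F v L' ->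
  strong_limit F (fun i => u i * v i) (L * L').
Proof.
move=> cu h h' x.
have : (u i (v i x - L' x)) @[i --> F] --> (0 : H).
  apply/cvg_nrmP; have /cvg_nrmP/cvgrPdist_lt h0 := h' x.
  apply/cvgrPdist_lt => e /h0; apply: filterS => i.
  rewrite !sub0r !normrN !ger0_norm ?nrm_ge0// => h1.
  by apply: le_lt_trans h1; rewrite subr0 ler_sqrt ?rin_ge0//; exact: cu.
move=> h0; have /(cvgD h0) := h (L' x); rewrite add0r; apply: cvg_trans.
apply: near_eq_cvg; near=> i; rewrite -[LHS]/(u i (v i x - L' x) + u i (L' x)).
by rewrite opB subrK.
Unshelve. all: by end_near. Qed.

(** Taking adjoints is weakly continuous, so that if the adjoints do converge
    strongly, then it is to the adjoint of the limit. *)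
Lemma strong_limit_adj u L L' :
  strong_limit F u L -> strong_limit F (fun i => adj (u i)) L' -> adj L = L'.
Proof.
move=> h h'; apply: adj_unique => x y.
have h1 : '[u i x, y] @[i --> F] --> '[L x, y].
  by apply: cvg_rin; [exact: h | exact: cvg_cst].
have h2 : '[u i x, y] @[i --> F] --> '[x, L' y].
  rewrite (_ : (fun i => _) = (fun i => '[x, adj (u i) y])).
    by apply: cvg_rin; [exact: cvg_cst | exact: h'].
  by apply/funext => i; rewrite rin_adj.
exact: (@norm_cvg_unique _ _ ('[u i x, y] @[i --> F])).
Qed.

Lemma strong_limit_ge u L T x : strong_limit F u L ->
  (\forall i \near F, '[T x] <= '[u i x]) -> '[T x] <= '[L x].
Proof.
move=> h hu; have c : '[u i x] @[i --> F] --> '[L x].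
  by apply: cvg_rin; exact: h.
by apply: (closed_cvg (fun r => '[T x] <= r) _ hu _ c); exact: closed_ge.
Qed.

Lemma strong_limit_commutant (S : set 'B(H)) u L : strong_limit F u L ->
  (\forall i \near F, commutant S (u i)) -> commutant S L.
Proof.
move=> h hu y Sy; apply: (@strong_limit_unique (fun i => u i * y)).
  by move=> x; exact: h.
move=> x; have h1 : strong_limit F (fun i => y * u i) (y * L) by exact: strong_limitMl.
have := h1 x; apply: cvg_trans; apply: near_eq_cvg.
by apply: filterS hu => i /(_ y Sy) ->.
Qed.

(** A von Neumann algebra is a commutant, and commutants are strongly closed
    because multiplication by a fixed operator on either side is strongly
    continuous. *)
Lemma strong_limit_vN (M : set 'B(H)) u L : is_vN M -> strong_limit F u L ->
  (\forall i \near F, M (u i)) -> M L.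
Proof.
move=> vM h hu; rewrite -(vN_bicommutant vM); apply: strong_limit_commutant h _.
by apply: filterS hu => i; rewrite -{1}(vN_bicommutant vM).
Qed.

(** For each x the squared norms of the u i x have a supremum, and once the squared
    norm of u i x is within e of it, every later u j x is within the square root
    of e of u i x.  The hypothesis on the differences holds for partial
    isometries that extend one another, and along Newton's iteration. *)
Lemma monotone_limit (le : I -> I -> Prop) u :
  (forall i, \forall j \near F, le i j) -> (forall i, nonexpansive (u i)) ->
  (forall i j x, le i j -> '[u j x - u i x] <= '[u j x] - '[u i x]) ->
  exists L, strong_limit F u L.
Proof.
move=> Fle cu mono.
have /choice[f hf] x : exists y, u i x @[i --> F] --> y.
  apply: cauchy_cvg_nrm => e e0.
  pose V := range (fun i => '[u i x]).
  have [i0 _] := @filter_ex _ F FF setT filterT.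
  have sV : has_sup V.
    split; first by exists '[u i0 x]; exists i0.
    by exists '[x] => _ [i _ <-]; exact: cu.
  have [_ [i _ <-] hi] := sup_adherent e0 sV.
  exists (u i x); apply: filterS (Fle i) => j /(mono _ _ x).
  have : '[u j x] <= sup V by apply: ub_le_sup; [exact: sV.2|exists j].
  lra.
have lf : linear f.
  move=> a x y; apply: (cvg_hilbert_unique (hf _)).
  rewrite (_ : (fun i => u i (a *: x + y)) = (fun i => a *: u i x + u i y)).
    by apply: cvgD; [apply: cvgZl_tmp; exact: hf | exact: hf].
  by apply/funext => i; rewrite op_linear.
have bf x : nrm (f x) <= 1 * nrm x.
  rewrite mul1r ler_sqrt ?rin_ge0//.
  have c : '[u i x] @[i --> F] --> '[f x] by apply: cvg_rin; exact: hf.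
  apply: (closed_cvg (fun r => r <= '[x]) _ _ _ c); first exact: closed_le.
  by near=> i; exact: cu.
have [L hL] := op_of_bound lf bf.
by exists L => x; rewrite hL; exact: hf.
Unshelve. all: by end_near. Qed.

End Filtered.

End StrongLimits.

(** * Polar decomposition by Newton's iteration *)

Section Newton.
Context {R : realType} {H : hilbertType R}.
Implicit Types (x y z : H) (a b : R[i]) (r s : R) (S T U L : 'B(H)).
Local Notation "''[' x , y ]" := (rin x y).
Local Notation "''[' x ]" := (rin x x).

Local Ltac oplin := let x := fresh in let z := fresh in
  apply: op_ext => x; apply: rin_ext => z;
  rewrite ?(opE, opD, opN, opZ) ?(rinDl, rinNl, rinZl); lra.

(** For 0 <= A <= 1, a set of polynomials in A with obviously nonnegative values: it
    contains all sums of products of A and 1 - A, which is what [posconeM] shows.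
    Conjugations rather than products appear among the constructors because
    conjugation by a self-adjoint operator preserves positivity ([poscone_ge0]);
    hence products of commuting positive operators need no square roots. *)
Inductive poscone A : 'B(H) -> Prop :=
| PosOne : poscone A 1
| PosA : poscone A A
| PosD : poscone A (1 - A)
| PosAD : poscone A (A * (1 - A))
| PosAdd S T of poscone A S & poscone A T : poscone A (S + T)
| PosScale r S of 0 <= r & poscone A S : poscone A (r%:C *: S)
| PosConjA S of poscone A S : poscone A (A * S * A)
| PosConjD S of poscone A S : poscone A ((1 - A) * S * (1 - A)).

Lemma posconeMA A S : poscone A S -> poscone A (A * S).
Proof.
have AD : A * (1 - A) = (1 - A) * A by rewrite mulrBr mulrBl mulr1 mul1r.
elim=> [||||{}S T _ IS _ IT|r {}S r0 _ IS|{}S _ IS|{}S _ IS].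
- by rewrite mulr1; exact: PosA.
- by rewrite -[A in A * _]mulr1; apply: PosConjA; exact: PosOne.
- exact: PosAD.
- by rewrite AD mulrA; apply: PosConjA; exact: PosD.
- by rewrite mulrDr; exact: PosAdd.
- by rewrite op_scaler; exact: PosScale.
- by rewrite mulrA; exact: PosConjA.
- by rewrite 2!mulrA AD -(mulrA (1 - A)); exact: PosConjD.
Qed.

Lemma posconeMD A S : poscone A S -> poscone A ((1 - A) * S).
Proof.
have AD : (1 - A) * A = A * (1 - A) by rewrite mulrBr mulrBl mulr1 mul1r.
elim=> [||||{}S T _ IS _ IT|r {}S r0 _ IS|{}S _ IS|{}S _ IS].
- by rewrite mulr1; exact: PosD.
- by rewrite AD; exact: PosAD.
- by rewrite -[X in X * _]mulr1; apply: PosConjD; exact: PosOne.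
- by rewrite mulrA; apply: PosConjD; exact: PosA.
- by rewrite mulrDr; exact: PosAdd.
- by rewrite op_scaler; exact: PosScale.
- by rewrite 2!mulrA AD -(mulrA A); exact: PosConjA.
- by rewrite mulrA; apply: PosConjD.
Qed.

Lemma posconeM A S T : poscone A S -> poscone A T -> poscone A (S * T).
Proof.
move=> pS; elim: pS T => [||||{}S U _ IS _ IU|r {}S r0 _ IS|{}S _ IS|{}S _ IS] T pT.
- by rewrite mul1r.
- exact: posconeMA.
- exact: posconeMD.
- by rewrite -mulrA; apply/posconeMA/posconeMD.
- by rewrite mulrDl; apply: PosAdd; [exact: IS|exact: IU].
- by rewrite op_scalel; apply: PosScale => //; exact: IS.
- by rewrite -!mulrA; apply/posconeMA/IS/posconeMA.
- by rewrite -!mulrA; apply/posconeMD/IS/posconeMD.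
Qed.

(** The one case that is not immediate is A (1 - A), which is the sum of the
    conjugates of 1 - A by A and of A by 1 - A. *)
Lemma poscone_ge0 A S x : adj A = A -> (forall y, 0 <= '[A y, y]) ->
  (forall y, '[A y, y] <= '[y]) -> poscone A S -> 0 <= '[S x, x].
Proof.
move=> aA A0 A1 pS.
have sA y z : '[A y, z] = '[y, A z] by rewrite rin_adj aA.
have D0 y : 0 <= '[(1 - A) y, y] by rewrite !opE rinDl rinNl subr_ge0.
have sD y z : '[(1 - A) y, z] = '[y, (1 - A) z].
  by rewrite rin_adj adjopB adjop1 aA.
elim: pS x => [||||{}S T _ IS _ IT|r {}S r0 _ IS|{}S _ IS|{}S _ IS] x //.
- exact: rin_ge0.
- have -> : A * (1 - A) = A * (1 - A) * A + (1 - A) * A * (1 - A).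
    oplin.
  rewrite opDE rinDl addr_ge0//; first by rewrite 2!opME sA.
  by rewrite 2!opME sD.
- by rewrite opE rinDl addr_ge0.
- by rewrite opE rinZl mulr_ge0.
- by rewrite 2!opME sA.
- by rewrite 2!opME sD.
Qed.

Definition newton_corr T := (2^-1 : R)%:C *: (1 - adj T * T).
(** One step of the iteration T |-> T (3 - T^* T) / 2.  Writing it as T (1 + E) with
    2 E = 1 - T^* T makes the positivity of the correction visible. *)
Definition newton T := T * (1 + newton_corr T).

Lemma newton_corrDD T : newton_corr T + newton_corr T = 1 - adj T * T.
Proof. rewrite /newton_corr; oplin. Qed.

Lemma newton_corr_adj T : adj (newton_corr T) = newton_corr T.
Proof.
by rewrite /newton_corr adjopZr adjopB adjop1 adjopM adjopK.
Qed.

Lemma adj_newton T : adj (newton T) = newton (adj T).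
Proof.
rewrite /newton adjopM adjopD adjop1 newton_corr_adj mulrDl mulrDr mul1r mulr1.
congr (_ + _); rewrite /newton_corr op_scalel op_scaler adjopK; congr (_ *: _).
by rewrite mulrBl mulrBr mul1r mulr1 mulrA.
Qed.

Lemma iter_newton_adj T k : adj (iter k newton T) = iter k newton (adj T).
Proof. by elim: k => //= k <-; rewrite adj_newton. Qed.

(** If S is an iterate and S^* S = 1 - 2 E, then the next iterate S (1 + E) has
    (1 + E) (1 - 2 E) (1 + E) in place of S^* S, and the identity
    1 - (1 + E) (1 - 2 E) (1 + E) = E^2 (3 + 2 E) keeps its complement in the
    cone. *)
Lemma newton_poscone T k : let Tk := iter k newton T in let A := adj T * T in
  [/\ exists2 P, poscone A P & Tk = T * (1 + P),
      poscone A (adj Tk * Tk) & poscone A (1 - adj Tk * Tk)].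
Proof.
move=> Tk A; rewrite {}/Tk; elim: k => [|k [[P pP eP] pA pD]].
  split; [|exact: PosA|exact: PosD].
  exists (0%:C *: (1 : 'B(H))); first by apply: PosScale => //; exact: PosOne.
  by rewrite scale0r addr0 mulr1.
rewrite iterS; move: (iter k _ T) eP pA pD => S eP pA pD.
have pE : poscone A (newton_corr S) by apply: PosScale => //; rewrite invr_ge0.
have pG : poscone A (1 + newton_corr S) by apply: PosAdd => //; exact: PosOne.
have eA : adj (newton S) * newton S =
    (1 + newton_corr S) * (adj S * S) * (1 + newton_corr S).
  by rewrite /newton adjopM adjopD adjop1 newton_corr_adj !mulrA.
split.
- exists (P + newton_corr S + P * newton_corr S).
    by apply: PosAdd; [exact: PosAdd|exact: posconeM].
  rewrite /newton eP -mulrA; congr (T * _).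
  by rewrite mulrDr mulr1 mulrDl mul1r -!addrA.
- by rewrite eA; apply: posconeM => //; exact: posconeM.
- have -> : 1 - adj (newton S) * newton S
     = newton_corr S * newton_corr S * (1 + (1 + newton_corr S) + (1 + newton_corr S)).
    rewrite eA; have -> : adj S * S = 1 - (newton_corr S + newton_corr S).
      by rewrite newton_corrDD opprB addrC subrK.
    move: (newton_corr S) => E; oplin.
  apply: posconeM; first exact: posconeM.
  by apply: PosAdd => //; apply: PosAdd => //; exact: PosOne.
Qed.

Lemma poscone_adj_ge0 T S x : nonexpansive T -> poscone (adj T * T) S ->
  0 <= '[S x, x].
Proof.
move=> cT; apply: poscone_ge0 => [|y|y]; first by rewrite adjopM adjopK.
  by rewrite opE rin_adjl rin_ge0.
by rewrite opE rin_adjl cT.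
Qed.

Lemma newton_nonexpansive T k : nonexpansive T -> nonexpansive (iter k newton T).
Proof.
move=> cT x; have [_ _ /(poscone_adj_ge0 x cT)] := newton_poscone T k.
by rewrite !opE rinDl rinNl rin_adjl subr_ge0.
Qed.

(** The k-th iterate is T + T P with P in the cone of T^* T, so that the cross term,
    the inner product of T x and T P x, is nonnegative. *)
Lemma newton_monotone T k x : nonexpansive T ->
  '[iter k newton T x - T x] <= '[iter k newton T x] - '[T x].
Proof.
move=> cT; have [[P pP ->] _ _] := newton_poscone T k.
have := poscone_adj_ge0 x cT (posconeMA pP).
rewrite mulrDr mulr1 !opE rin_adjl [T x + _]addrC addrK rinDD; lra.
Qed.

(** The limit is a partial isometry because it is a fixed point of the iteration.
    The iteration commutes with taking adjoints, so that the adjoints converge as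
    well.  As the norms of the iterates at x increase, V dominates T and V^*
    dominates T^*; so the kernels of V and V^* are contained in those of T and
    T^*. *)
Lemma newton_limit T : nonexpansive T -> exists V,
  [/\ strong_limit \oo (fun k => iter k newton T) V,
      strong_limit \oo (fun k => adj (iter k newton T)) (adj V),
      V * adj V * V = V,
      (forall x, '[T x] <= '[V x]) & (forall x, '[adj T x] <= '[adj V x])].
Proof.
have ex S : nonexpansive S -> exists V, strong_limit \oo (fun k => iter k newton S) V.
  move=> cS; apply: (@monotone_limit _ _ _ _ _ (fun i j => (i <= j)%N)).
  - by move=> i; exists i.
  - by move=> i; exact: newton_nonexpansive.
  - move=> i j x ij; rewrite -(subnK ij) iterD.
    exact/newton_monotone/newton_nonexpansive.
have ge S V x : nonexpansive S -> strong_limit \oo (fun k => iter k newton S) V ->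
    '[S x] <= '[V x].
  move=> cS lV; apply: (strong_limit_ge lV); apply: nearW => k.
  by rewrite -subr_ge0; apply: le_trans (newton_monotone k x cS); exact: rin_ge0.
move=> cT; have [V lV] := ex _ cT; have [V' lV'] := ex _ (nonexpansive_adj cT).
have lV'' : strong_limit \oo (fun k => adj (iter k newton T)) V'.
  by move=> x; under eq_fun do rewrite iter_newton_adj; exact: lV'.
have eV := strong_limit_adj lV lV''; rewrite -eV in lV' lV''.
have cV k : nonexpansive (iter k newton T) by exact: newton_nonexpansive.
exists V; split=> // [|x|x]; last 2 first.
- exact: ge.
- by apply: ge => //; exact: nonexpansive_adj.
have l1 : strong_limit \oo (fun k => iter k.+1 newton T) V.
  by move=> x; exact: cvg_comp (cvg_addnl 1) (lV x).
(* the iteration itself, in the limit *)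
have l2 : strong_limit \oo (fun k => iter k.+1 newton T)
   (V * (1 + (2^-1 : R)%:C *: (1 - adj V * V))).
  apply: strong_limitM => //; apply: strong_limitD; first exact: strong_limit_cst.
  apply: strong_limitZ; apply: strong_limitB; first exact: strong_limit_cst.
  by apply: strong_limitM => // k; exact/nonexpansive_adj/cV.
have /eqP : V = V * (1 + (2^-1 : R)%:C *: (1 - adj V * V)).
  exact: strong_limit_unique l1 l2.
rewrite mulrDr mulr1 op_scaler eq_sym addrC -subr_eq0 addrK.
rewrite scaler_eq0 fmorph_eq0 invr_eq0 pnatr_eq0 /= mulrBr mulr1 subr_eq0 mulrA.
by move/eqP.
Qed.

End Newton.

(** * Von Neumann algebras and polar decomposition of normalisers *)

Section Algebras.
Context {R : realType} {H : hilbertType R}.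
Implicit Types (h x y z : H) (a : R[i]) (r s : R) (S T U L c : 'B(H)).
Implicit Types (A B M N : set 'B(H)) (b e f n u v w : 'B(H)).
Local Notation "''[' x , y ]" := (rin x y).
Local Notation "''[' x ]" := (rin x x).

Section Closure.
Variables (M : set 'B(H)) (vM : is_vN M).

Lemma vN0 : M 0.
Proof.
by have := vN_linear vM (-1) (vN_one vM) (vN_one vM); rewrite scaleN1r addNr.
Qed.
Lemma vND S T : M S -> M T -> M (S + T).
Proof. by move=> MS MT; rewrite -[S]scale1r; exact: vN_linear. Qed.
Lemma vNZ a T : M T -> M (a *: T).
Proof. by move=> MT; rewrite -[_ *: _]addr0; apply: vN_linear => //; exact: vN0. Qed.
Lemma vNB S T : M S -> M T -> M (S - T).
Proof. by move=> MS MT; rewrite -scaleN1r; apply: vND => //; exact: vNZ. Qed.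
Lemma vNM S T : M S -> M T -> M (S * T). Proof. exact: vN_mul. Qed.
Lemma vN1 : M 1. Proof. exact: vN_one. Qed.

Lemma vN_newton_corr T : M (adj T * T) -> M (1 + newton_corr T).
Proof.
move=> h; apply: vND; first exact: vN1.
by apply: vNZ; apply: vNB => //; exact: vN1.
Qed.

Lemma vN_iter_newton T k : M T -> M (iter k newton T).
Proof.
move=> MT; elim: k => //= k; move: (iter k _ _) => S MS.
by apply: vNM => //; apply/vN_newton_corr/vNM => //; exact: vN_adj.
Qed.

Lemma vN_newton_limit T V : M T ->
  strong_limit \oo (fun k => iter k newton T) V -> M V.
Proof.
move=> MT h; apply: strong_limit_vN h _ => //; apply: nearW => k.
exact: vN_iter_newton.
Qed.

Lemma commutant_adj S : commutant M S -> commutant M (adj S).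
Proof.
by move=> h y /(vN_adj vM)/h /(congr1 adj); rewrite !adjopM !adjopK.
Qed.

End Closure.

Lemma scale_nonexpansive T : exists2 r, 0 < r & nonexpansive (r%:C *: T).
Proof.
have [k k0 hk] := op_bound T; exists k^-1; first by rewrite invr_gt0.
move=> x; rewrite opZE rinZl rinZr mulrA -invfM ler_pdivrMl ?mulr_gt0//.
by rewrite -!nrm_sq -expr2 -exprMn ler_sqr ?nnegrE ?mulr_ge0 ?nrm_ge0// ltW.
Qed.

Lemma realC_neq0 r : 0 < r -> (r%:C : R[i]) != 0.
Proof. by move=> r0; rewrite fmorph_eq0 gt_eqF. Qed.

(** A domination of norms is an inclusion of kernels. *)
Lemma dominated_mul_eq0 S T U : (forall x, '[T x] <= '[S x]) -> S * U = 0 -> T * U = 0.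
Proof.
move=> h SU; apply: op_ext => x; apply: rin_eq0; apply/eqP.
by rewrite eq_le rin_ge0 andbT (le_trans (h _))// -opME SU rin0l.
Qed.

Definition pisom v := v * adj v * v = v.

Lemma pisom_adj v : pisom v -> adj v * v * adj v = adj v.
Proof. by rewrite /pisom => /(congr1 adj); rewrite !adjopM adjopK mulrA. Qed.

(** The domination says that V V^* is 1 on the range of T.  The second factor
    V^* T plays the role of the absolute value of T. *)
Lemma polar T V : pisom V -> (forall x, '[adj T x] <= '[adj V x]) ->
  T = V * (adj V * T).
Proof.
move=> pV dV; rewrite mulrA; apply/esym/eqP; rewrite -subr_eq0; apply/eqP.
have e : adj V * (V * adj V - 1) = 0.
  by rewrite mulrBr mulr1 mulrA pisom_adj// subrr.
have := dominated_mul_eq0 dV e => /(congr1 adj).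
by rewrite adjopM adjop0 adjopK adjopB adjop1 adjopM adjopK mulrBl mul1r.
Qed.

Lemma pisom_nonexpansive v : pisom v -> nonexpansive v.
Proof.
move=> pv x; have [->|vx0] := eqVneq (v x) 0; first by rewrite rin0r rin_ge0.
have e : '[adj v (v x)] = '[v x] by rewrite rin_adjl -!opME pv.
have := rin_CauchySchwarz (adj v (v x)) x; rewrite rin_adjl e expr2.
by rewrite ler_pM2l// rin_gt0.
Qed.

Lemma normaliserP M B n : normaliser M B n <->
  [/\ M n, forall b, B b -> B (n * b * adj n) & forall b, B b -> B (adj n * b * n)].
Proof.
split=> [[Mn nB]|[Mn nB nB']].
  by split=> // b Bb; apply: nB; [left|right]; exists b.
by split=> // _ [|] [b Bb <-]; [exact: nB|exact: nB'].
Qed.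

(** As n^* n lies in B, this makes every iterate of Newton's iteration that starts
    at a normaliser a normaliser, for they are n times elements of B. *)
Lemma normaliserMr M B n g : is_vN M -> is_vN B -> B `<=` M ->
  normaliser M B n -> B g -> normaliser M B (n * g).
Proof.
move=> vM vB BM /normaliserP[Mn nB nB'] Bg; apply/normaliserP; split=> [|b Bb|b Bb].
- by apply: vNM => //; exact: BM.
- have -> : n * g * b * adj (n * g) = n * (g * b * adj g) * adj n.
    by rewrite adjopM !mulrA.
  by apply: nB; do 2?apply: vNM => //; exact: vN_adj.
- have -> : adj (n * g) * b * (n * g) = adj g * (adj n * b * n) * g.
    by rewrite adjopM !mulrA.
  by do 2?apply: vNM => //; [exact: vN_adj|exact: nB'].
Qed.

(** Newton's iteration on (a multiple of) n runs within the normalisers, so its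
    limit V normalises B; and V^* n is the limit of the products of the adjoint
    iterates with n, which belong to B. *)
Lemma normaliser_polar M B n : is_vN M -> is_vN B -> B `<=` M ->
  normaliser M B n -> exists v b, [/\ groupoid_normaliser M B v, B b & n = v * b].
Proof.
move=> vM vB BM nn; have [r r0 cT] := scale_nonexpansive n.
set T := _ *: n in cT.
have nT : normaliser M B T.
  rewrite /T -[n]mulr1 -op_scaler; apply: normaliserMr => //.
  by apply: vNZ => //; exact: vN1.
have nk k : normaliser M B (iter k newton T).
  elim: k => //= k IH; apply: normaliserMr => //; apply: vN_newton_corr => //.
  by have /normaliserP[_ _ /(_ 1 (vN1 vB))] := IH; rewrite mulr1.
have ck k : nonexpansive (iter k newton T) by exact: newton_nonexpansive.
have [V [lV lV' pV _ dV]] := newton_limit cT.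
have nV : normaliser M B V.
  apply/normaliserP; split=> [|b Bb|b Bb].
  - by apply: (vN_newton_limit vM _ lV); case: nT.
  - have h : strong_limit \oo (fun k => iter k newton T * (b * adj (iter k newton T)))
        (V * (b * adj V)).
      by apply: strong_limitM => //; exact: strong_limitMl.
    rewrite -mulrA; apply: (strong_limit_vN vB h).
    by apply: nearW => k; rewrite mulrA; have /normaliserP[_ + _] := nk k; exact.
  - have h : strong_limit \oo (fun k => adj (iter k newton T) * (b * iter k newton T))
        (adj V * (b * V)).
      by apply: strong_limitM; [move=> k; exact: nonexpansive_adj| |exact: strong_limitMl].
    rewrite -mulrA; apply: (strong_limit_vN vB h).
    by apply: nearW => k; rewrite mulrA; have /normaliserP[_ _] := nk k; exact.
have BV : B (adj V * T).
  have h : strong_limit \oo (fun k => adj (iter k newton T) * T) (adj V * T).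
    by move=> x; exact: lV'.
  apply: (strong_limit_vN vB h); apply: nearW; elim=> [|k IH] /=.
    by have /normaliserP[_ _ /(_ 1 (vN1 vB))] := nT; rewrite mulr1.
  rewrite {1}/newton adjopM -mulrA; apply: vNM => //; apply: vN_adj => //.
  apply: vN_newton_corr => //.
  by have /normaliserP[_ _ /(_ 1 (vN1 vB))] := nk k; rewrite mulr1.
exists V, ((r%:C)^-1 *: (adj V * T)); split=> //; first exact: vNZ.
by rewrite op_scaler -polar// scalerA mulVf ?scale1r// realC_neq0.
Qed.

End Algebras.

(** * Generation by unitaries and comparison of projections *)

Section Unitaries.
Context {R : realType} {H : hilbertType R}.
Implicit Types (h x y z : H) (r s : R) (S T U L c : 'B(H)).
Implicit Types (A B M N : set 'B(H)) (a b e f n u v w : 'B(H)).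
Local Notation "''[' x , y ]" := (rin x y).
Local Notation "''[' x ]" := (rin x x).

(** Here all terms are polynomials in T and T^*, which commute. *)
Lemma newton_normal T k : adj T * T = T * adj T ->
  let S := iter k newton T in
  adj S * S = S * adj S /\ adj T * S = T * adj S.
Proof.
move=> nT /=; elim: k => //= k [nS eS].
move: (iter k newton T) nS eS => S nS eS.
have eG : newton_corr (adj S) = newton_corr S by rewrite /newton_corr adjopK nS.
have aS : adj (newton S) = adj S * (1 + newton_corr S).
  by rewrite adj_newton /newton eG.
have cS : (1 + newton_corr S) * S = S * (1 + newton_corr S).
  rewrite mulrDl mulrDr mul1r mulr1; congr (_ + _).
  rewrite /newton_corr op_scalel op_scaler; congr (_ *: _).
  by rewrite mulrBl mulrBr mul1r mulr1 {1}nS mulrA.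
have caS : (1 + newton_corr S) * adj S = adj S * (1 + newton_corr S).
  by have := congr1 adj cS; rewrite !adjopM adjopD adjop1 newton_corr_adj.
rewrite aS; split; last by rewrite /newton !mulrA eS.
rewrite /newton !mulrA -[adj S * _ * S]mulrA cS -[S * _ * adj S]mulrA caS.
by rewrite !mulrA nS.
Qed.

(** Apply Newton's iteration to 1 + 'i a, normalised to a contraction T.  This
    operator is normal and bounded below, so its polar part V, which is formally
    (1 + 'i a) / sqrt (1 + a^2), is a unitary of B; moreover T^* V = T V^*, that
    is V - V^* = 'i a (V + V^* ).  An operator c in the commutant of N commutes
    with V and V^*, hence (a c - c a) (V + V^* ) = 0; since V + V^* is
    self-adjoint and injective, its range is dense and c commutes with a. *)
Lemma selfadjoint_mem_unitaries B N a : is_vN B -> is_vN N ->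
  (forall u, B u -> is_unitary u -> N u) -> B a -> adj a = a -> N a.
Proof.
move=> vB vN UN Ba aa.
have ima : adj ('i *: a) = - ('i *: a).
  by rewrite adjopZ aa conjCi scaleNr.
have ort x : '[x, 'i *: a x] = 0.
  have : '[x, ('i *: a) x] = - '[x, ('i *: a) x].
    by rewrite -{1}rin_adjl ima opNE rinNl rinC.
  by rewrite opE => ?; lra.
have [r r0 cT] := scale_nonexpansive (1 + 'i *: a).
set T := r%:C *: _ in cT.
have aT : adj T = r%:C *: (1 - 'i *: a) by rewrite /T adjopZr adjopD adjop1 ima.
have nT : adj T * T = T * adj T.
  rewrite aT /T !(op_scalel, op_scaler); congr (_ *: (_ *: _)).
  move: ('i *: a) => X; rewrite mulrDr mulr1 mulrBl mul1r addrA subrK.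
  by rewrite mulrBr mulr1 mulrDl mul1r opprD addrA addrK.
(* r^2 (1 + a^2) >= r^2 *)
have low x : r ^+ 2 * '[x] <= '[T x].
  rewrite opZE rinZl rinZr mulrA -expr2 ler_wpM2l ?sqr_ge0// !opE rinDD ort.
  by rewrite mulr0 addr0 lerDl rin_ge0.
have lowa x : r ^+ 2 * '[x] <= '[adj T x].
  by rewrite rin_adjl -opME -nT opME -rin_adj low.
have [V [lV lV' pV dV dV']] := newton_limit cT.
have inj S U : (forall x, r ^+ 2 * '[x] <= '[S x]) -> S * U = 0 -> U = 0.
  move=> hS SU; apply: op_ext => x; apply: rin_eq0; apply/eqP.
  have := hS (U x); rewrite -opME SU rin0l pmulr_rle0 ?exprn_gt0// => h.
  by rewrite eq_le h rin_ge0.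
have VV : adj V * V = 1.
  apply/eqP; rewrite -subr_eq0; apply/eqP/(inj V) => [x|].
    exact: le_trans (low x) (dV x).
  by rewrite mulrBr mulr1 mulrA pV subrr.
have VV' : V * adj V = 1.
  apply/eqP; rewrite -subr_eq0; apply/eqP/(inj (adj V)) => [x|].
    exact: le_trans (lowa x) (dV' x).
  by rewrite mulrBr mulr1 mulrA pisom_adj// subrr.
have BT : B T.
  by apply: vNZ => //; apply: vND => //; [exact: vN1|exact: vNZ].
have NV : N V by apply: UN; [exact: vN_newton_limit lV|].
have NV' : N (adj V) by exact: vN_adj.
have TV : adj T * V = T * adj V.
  have h1 : strong_limit \oo (fun k => adj T * iter k newton T) (adj T * V).
    exact: strong_limitMl.
  have h2 : strong_limit \oo (fun k => adj T * iter k newton T) (T * adj V).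
    rewrite (_ : (fun k => _) = (fun k => T * adj (iter k newton T))).
      exact: strong_limitMl.
    by apply/funext => k; have [] := newton_normal k nT.
  exact: strong_limit_unique h1 h2.
have E : V - adj V = ('i *: a) * (V + adj V).
  rewrite aT /T !(op_scalel (r%:C)) in TV; move: (scalerI (realC_neq0 r0) TV).
  move: ('i *: a) => X; rewrite mulrBl mulrDl !mul1r => /eqP; rewrite subr_eq => /eqP e.
  by apply/eqP; rewrite subr_eq mulrDr -addrA [X * _ + adj V]addrC addrC -e.
rewrite -(vN_bicommutant vN) => c Nc.
have cV : V * c = c * V by apply/esym; exact: Nc.
have cV' : adj V * c = c * adj V by apply/esym; exact: Nc.
have : (('i *: a) * c - c * ('i *: a)) * (V + adj V) = 0.
  rewrite mulrBl -!mulrA -E mulrDr -cV -cV' -mulrDl !mulrA -E.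
  by rewrite mulrBl mulrBr cV cV' subrr.
move=> /(congr1 adj); rewrite adjopM adjop0 adjopD adjopK addrC => h.
have {h} : adj (('i *: a) * c - c * ('i *: a)) = 0.
  move: (adj (_ - _)) h => D h.
  (* V + V^* vanishes on the range of D, and by E so does V - V^* *)
  have h' : (V - adj V) * D = 0 by rewrite E -mulrA h mulr0.
  have : V * D + V * D = 0.
    have <- : (V + adj V) * D + (V - adj V) * D = V * D + V * D.
      by rewrite mulrDl mulrBl addrACA subrr addr0.
    by rewrite h h' addr0.
  rewrite -mulr2n -scaler_nat => /eqP; rewrite scaler_eq0 pnatr_eq0 /= => /eqP VD.
  by rewrite -[D]mul1r -VV -mulrA VD mulr0.
move=> /(congr1 adj); rewrite adjopK adjop0 op_scalel op_scaler -scalerBr => /eqP.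
by rewrite scaler_eq0 (negPf (neq0Ci _)) /= subr_eq0 => /eqP.
Qed.

(** Every element is a combination of two self-adjoint ones. *)
Lemma vN_unitaries B N : is_vN B -> is_vN N ->
  (forall u, B u -> is_unitary u -> N u) -> B `<=` N.
Proof.
move=> vB vN UN x Bx; have Bx' := vN_adj vB Bx.
have N1 : N (x + adj x).
  apply: (selfadjoint_mem_unitaries vB vN UN); first exact: vND.
  by rewrite adjopD adjopK addrC.
have N2 : N ('i *: (x - adj x)).
  apply: (selfadjoint_mem_unitaries vB vN UN); first by apply: vNZ => //; exact: vNB.
  by rewrite adjopZ adjopB adjopK conjCi scaleNr -scalerN opprB.
have -> : x = 2^-1 *: ((x + adj x) + (- 'i) *: ('i *: (x - adj x))).
  rewrite scalerA mulNr -expr2 sqrCi opprK scale1r addrACA subrr addr0.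
  by rewrite -(mulr2n x) -(scaler_nat 2 x) scalerA mulVf ?scale1r// pnatr_eq0.
by apply: vNZ => //; apply: vND => //; exact: vNZ.
Qed.

Lemma orthogonal_projection (D : set H) : linear_subset D -> closed D ->
  exists z : 'B(H), (forall x, D (z x)) /\ (forall x y, D y -> '[x - z x, y] = 0).
Proof.
move=> sD Dc; have [D0 DL] := sD.
have /choice[f hf] x : exists p, D p /\ forall y, D y -> '[x - p, y] = 0.
  by have [p] := orthogonal_decomposition x sD Dc; exists p.
have DB x y : D x -> D y -> D (x - y).
  by move=> Dx Dy; rewrite addrC -scaleN1r; exact: DL.
have uniq x p : D p -> (forall y, D y -> '[x - p, y] = 0) -> p = f x.
  move=> Dp hp; have [Df hfx] := hf x; apply/eqP; rewrite -subr_eq0; apply/eqP/rin_eq0.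
  have -> : '[p - f x] = '[x - f x, p - f x] - '[x - p, p - f x].
    by rewrite -rinBl; congr (rin _ _); rewrite opprB [RHS]addrC addrA subrK.
  by rewrite hp ?hfx ?subrr//; exact: DB.
have lf : linear f.
  move=> a x y; apply/esym/uniq => [|d Dd].
    by apply: DL; [exact: (hf x).1|exact: (hf y).1].
  rewrite opprD addrACA -scalerBr rinDl (hf y).2// addr0 /rin innerZl.
  by rewrite (orthogonal_inner sD (hf x).2)// mulr0.
have [|z hz] := @op_of_bound _ _ f 1 lf.
  move=> x; rewrite mul1r ler_sqrt ?rin_ge0//.
  have -> : '[x] = '[x - f x + f x] by rewrite subrK.
  rewrite rinDD ((hf x).2 _ (hf x).1).
  by rewrite mulr0 addr0 lerDr rin_ge0.
exists z; split=> [x|x y Dy]; rewrite hz; first exact: (hf x).1.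
exact: (hf x).2.
Qed.

(** If c and c^* preserve D, then c preserves D and its orthogonal complement. *)
Lemma projection_commute (D : set H) (z c : 'B(H)) : linear_subset D ->
  (forall x, D (z x)) -> (forall x y, D y -> '[x - z x, y] = 0) ->
  (forall x, D x -> D (c x)) -> (forall x, D x -> D (adj c x)) -> z * c = c * z.
Proof.
move=> [_ DL] zD zo cD cD'; apply: op_ext => x; rewrite !opME; apply/eqP.
rewrite -subr_eq0; apply/eqP/rin_eq0; set d := z (c x) - c (z x).
have Dd : D d by rewrite /d addrC -scaleN1r; apply: DL => //; exact: cD.
have -> : '[d] = '[c (x - z x), d] - '[c x - z (c x), d].
  by rewrite -rinBl opB; congr (rin _ _); rewrite opprB [RHS]addrC addrA subrK.
by rewrite rin_adj !zo ?subrr//; exact: cD'.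
Qed.

(** Otherwise let D be the set of the h such that f b h = 0 for all b in B.  This
    closed subspace contains the range of e, and it is invariant under B and
    under the commutant of B; so the projection onto D is central in B, hence a
    scalar.  This scalar is 1 because e is not zero, so D is the whole space and
    f = 0. *)
Lemma factor_prime B f e : is_factor B -> B f -> f != 0 -> e != 0 ->
  exists2 b, B b & f * b * e != 0.
Proof.
move=> [vB _ cB] Bf f0 e0; apply: contrapT => nb.
have fbe b : B b -> f * b * e = 0.
  by move=> Bb; apply/eqP/negP => /negP h; apply: nb; exists b.
pose D := [set h | forall b, B b -> f (b h) = 0].
have sD : linear_subset D.
  split=> [b Bb|k x y Dx Dy b Bb]; first by rewrite !op0.
  by rewrite opD opZ opD opZ Dx// Dy// scaler0 addr0.
have Dc : closed D.
  rewrite (_ : D = \bigcap_(b in B) [set h | (f * b) h = 0]).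
    by apply: closed_bigI => b _; exact: closed_ker.
  by apply/seteqP; split.
have [z [zD zo]] := orthogonal_projection sD Dc.
have cz : center B z.
  split.
    rewrite -(vN_bicommutant vB) => c Bc.
    have inv c' : commutant B c' -> forall x, D x -> D (c' x).
      move=> h x Dx b Bb; have -> : f (b (c' x)) = c' ((f * b) x).
        by rewrite -[RHS]opME (h _ (vNM vB Bf Bb)).
      by rewrite opME Dx// op0.
    apply: projection_commute sD zD zo _ _; apply: inv => //.
    exact: commutant_adj.
  move=> b Bb.
  have inv b' : B b' -> forall x, D x -> D (b' x).
    by move=> Bb' x Dx b'' Bb''; rewrite -(opME b''); apply: Dx; exact: vNM.
  by apply: projection_commute sD zD zo _ _; apply: inv => //; exact: vN_adj.
move: cz; rewrite cB => -[k _ ez].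
have De x : D (e x) by move=> b Bb; rewrite -!opME fbe.
have ze x : z (e x) = e x.
  apply/esym/eqP; rewrite -subr_eq0; apply/eqP/rin_eq0/zo.
  have [_ DL] := sD; by rewrite addrC -scaleN1r; exact: DL.
have k1 : k = 1.
  apply/eqP; rewrite -subr_eq0; apply: contraNT e0 => k0; apply/eqP/op_ext => x.
  have := ze x; rewrite -ez opZE op1E => /eqP; rewrite -subr_eq0 -{2}[e x]scale1r.
  by rewrite -scalerBl scaler_eq0 (negPf k0) => /eqP.
move: f0; rewrite (_ : f = 0) ?eqxx//; apply: op_ext => x.
by have := zD x 1 (vN1 vB); rewrite -ez k1 scale1r.
Qed.

(** The comparison of projections: w^* w and w w^* are equivalent nonzero
    subprojections of e and f.  It is the polar part of any nonzero f b e, and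
    f T = T and T e = T are preserved by Newton's iteration. *)
Lemma factor_pisom B f e : is_factor B -> B f -> B e -> f != 0 -> e != 0 ->
  f * f = f -> e * e = e ->
  exists w, [/\ B w, w != 0, w * adj w * w = w, f * w = w & w * e = w].
Proof.
move=> fB Bf Be f0 e0 ff ee; have [vB _ _] := fB.
have [b Bb fbe] := factor_prime fB Bf f0 e0.
have [r r0 cT] := scale_nonexpansive (f * b * e).
set T := _ *: _ in cT.
have BT : B T by apply: vNZ => //; do 2?apply: vNM.
have T0 : T != 0 by rewrite scaler_eq0 negb_or realC_neq0.
have Tk k : f * iter k newton T = iter k newton T /\
    iter k newton T * e = iter k newton T.
  elim: k => [|k [IH1 IH2]] /=.
    by rewrite /T op_scaler op_scalel !mulrA ff -(mulrA (f * b)) ee.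
  split; first by rewrite /newton mulrA IH1.
  move: (iter k newton T) IH2 => S Se; rewrite /newton /newton_corr -mulrA.
  rewrite mulrDl mul1r op_scalel mulrBl mul1r -mulrA Se !mulrDr mulr1 Se.
  by rewrite !op_scaler !mulrBr mulr1 Se.
have [V [lV _ pV dV _]] := newton_limit cT.
exists V; split=> //.
- exact: vN_newton_limit lV.
- apply: contra T0 => /eqP V0; apply/eqP; rewrite -[T]mulr1.
  by apply: (dominated_mul_eq0 dV); rewrite V0 mul0r.
- have h1 : strong_limit \oo (fun k => iter k newton T) (f * V).
    rewrite (_ : (fun k => _) = (fun k => f * iter k newton T)).
      exact: strong_limitMl.
    by apply/funext => k; case: (Tk k).
  exact: strong_limit_unique h1 lV.
- have h1 : strong_limit \oo (fun k => iter k newton T) (V * e).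
    rewrite (_ : (fun k => _) = (fun k => iter k newton T * e)).
      by move=> x; exact: lV.
    by apply/funext => k; case: (Tk k).
  exact: strong_limit_unique h1 lV.
Qed.

End Unitaries.

(** * Extension of groupoid normalisers to unitaries *)

Section Extension.
Context {R : realType} {H : hilbertType R}.
Implicit Types (x y z : H) (r : R) (S T L : 'B(H)).
Implicit Types (B M N : set 'B(H)) (b e f n s t u v w : 'B(H)).
Local Notation "''[' x , y ]" := (rin x y).
Local Notation "''[' x ]" := (rin x x).

(** For a partial isometry v, this says that u = v on the support of v and that u^*
    = v^* on the range of v, in a form that is symmetric under taking adjoints. *)
Definition extends u v := u * adj v = v * adj v /\ adj u * v = adj v * v.

Lemma extends_refl u : extends u u. Proof. by []. Qed.

Lemma extends_adj u v : extends u v -> extends (adj u) (adj v).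
Proof. by move=> [e1 e2]; split; rewrite !adjopK. Qed.

Lemma extends_trans u v w : pisom w -> extends u v -> extends v w -> extends u w.
Proof.
move=> pw [e1 e2] [e3 e4]; have pw' := pisom_adj pw; split.
  by rewrite -{1}pw' -e4 !mulrA e1 -(mulrA v) e4 -mulrA pw' e3.
by rewrite -{1}pw -e3 !mulrA e2 -(mulrA (adj v)) e3 -mulrA pw e4.
Qed.

(** u x - v x is orthogonal to v x. *)
Lemma extends_dist u v x : pisom v -> extends u v ->
  '[u x - v x] <= '[u x] - '[v x].
Proof.
move=> pv [_ e]; rewrite rinBB.
have -> : '[u x, v x] = '[v x].
  by rewrite rin_adj -opME e opME -rin_adj.
lra.
Qed.

(** The chain and the chain of its adjoints both satisfy the hypothesis of
    [monotone_limit] along the filter of its upper sections. *)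
Lemma chain_limit (C : set 'B(H)) : C !=set0 -> (forall u, C u -> pisom u) ->
  (forall u v, C u -> C v -> extends u v \/ extends v u) ->
  exists (I : Type) (F : set_system I) (u : I -> 'B(H)) L,
  [/\ ProperFilter F, forall i, C (u i), strong_limit F u L,
      strong_limit F (fun i => adj (u i)) (adj L) &
      forall v, C v -> \forall i \near F, extends (u i) v].
Proof.
move=> [u0 Cu0] pC tC.
pose I := {u | C u}; pose le (i j : I) := extends (sval j) (sval i).
have pI (i : I) : pisom (sval i) by apply: pC; exact: (svalP i).
pose F := filter_from [set: I] (fun i => [set j | le i j]).
have FF : ProperFilter F.
  apply: filter_from_proper; last by move=> i _; exists i; exact: extends_refl.
  apply: filter_from_filter; first by exists (exist _ u0 Cu0).
  move=> i j _ _; have [ij|ji] := tC _ _ (svalP i) (svalP j).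
    by exists i => // k ik; split=> //; exact: (extends_trans (pI j) ik ij).
  by exists j => // k jk; split=> //; exact: (extends_trans (pI i) jk ji).
have Fle i : \forall j \near F, le i j by exists i.
have nI (i : I) : nonexpansive (sval i) by exact: pisom_nonexpansive (pI i).
have [L hL] : exists L, strong_limit F sval L.
  by apply: (monotone_limit Fle nI) => i j x ij; exact: extends_dist (pI i) ij.
have [L' hL'] : exists L', strong_limit F (fun i : I => adj (sval i)) L'.
  apply: (monotone_limit Fle) => [i|i j x /extends_adj ij]; first exact: nonexpansive_adj.
  by apply: extends_dist ij; rewrite /pisom adjopK; exact: pisom_adj (pI i).
have e : adj L = L' by exact: strong_limit_adj hL hL'.
exists I, F, sval, L; split=> //; first by move=> i; exact: (svalP i).
  by rewrite e.
by move=> v Cv; exact: (Fle (exist _ v Cv)).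
Qed.

(** Normalising B would not be stable under adding pieces of the form y v w^*; the
    conditions linking u to v are what takes care of the cross terms. *)
Definition joint_normaliser M B v u :=
  [/\ M u, pisom u, forall b, B b -> B (u * b * adj u) /\ B (adj u * b * u)
    & forall b, B b -> B (u * b * adj v) /\ B (adj u * b * v)].

(** Zorn's lemma.  All the conditions pass to the strong limit of a chain, because
    the chain and its adjoints converge strongly and consist of contractions. *)
Lemma maximal_extension M B v : is_vN M -> is_vN B ->
  groupoid_normaliser M B v -> exists u,
  [/\ joint_normaliser M B v u, extends u v &
     forall s, joint_normaliser M B v s -> extends s u -> extends u s].
Proof.
move=> vM vB [/normaliserP[Mv vB1 vB2] pv].
have Jv : joint_normaliser M B v v by split=> // b Bb; split; auto.
pose T := {u | joint_normaliser M B v u /\ extends u v}.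
have pT (i : T) : pisom (sval i) by case: (svalP i) => -[].
pose le (i j : T) := `[< extends (sval j) (sval i) >].
have t0 : T by exists v; split=> //; exact: extends_refl.
have [||A tA|[u [Ju uv]] hu] := @ZL_preorder T t0 le.
- by move=> i; apply/asboolP/extends_refl.
- by move=> i j k /asboolP ij /asboolP jk; apply/asboolP/(extends_trans _ jk).
- have [[a Aa]|A0] := pselect (A !=set0); last first.
    by exists t0 => s As; exfalso; apply: A0; exists s.
  pose C := [set sval i | i in A].
  have pC u : C u -> pisom u by move=> [i _ <-].
  have [||I [F [u [L [FF Cu hL hL' eL]]]]] := chain_limit _ pC.
  + by exists (sval a); exists a.
  + by move=> _ _ [i Ai <-] [j Aj <-]; have [/asboolP|/asboolP] := tA _ _ Ai Aj; auto.
  have Ju i : joint_normaliser M B v (u i) by have [k _ <-] := Cu i; case: (svalP k).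
  have nu i : nonexpansive (u i) by apply: pisom_nonexpansive; case: (Ju i).
  have nu' i : nonexpansive (adj (u i)) by exact: nonexpansive_adj.
  have LC w : C w -> extends L w.
    move=> Cw; split.
      have h1 : strong_limit F (fun i => u i * adj w) (L * adj w) by move=> x; exact: hL.
      apply: strong_limit_unique h1 _ => x; apply: cvg_near_cst.
      by apply: filterS (eL _ Cw) => i [-> _].
    have h1 : strong_limit F (fun i => adj (u i) * w) (adj L * w) by move=> x; exact: hL'.
    apply: strong_limit_unique h1 _ => x; apply: cvg_near_cst.
    by apply: filterS (eL _ Cw) => i [_ ->].
  have JL : joint_normaliser M B v L.
    split=> [|||].
    + by apply: (strong_limit_vN vM hL); apply: nearW => i; case: (Ju i).
    + have h : strong_limit F (fun i => u i * (adj (u i) * u i)) (L * (adj L * L)).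
        by apply: strong_limitM => //; exact: strong_limitM.
      have h1 : strong_limit F u (L * (adj L * L)).
        rewrite (_ : u = fun i => u i * (adj (u i) * u i))//.
        by apply/funext => i; rewrite mulrA; case: (Ju i).
      by rewrite /pisom -mulrA; exact: strong_limit_unique h1 hL.
    + move=> b Bb; rewrite -!mulrA; split.
        have h : strong_limit F (fun i => u i * (b * adj (u i))) (L * (b * adj L)).
          by apply: strong_limitM => //; exact: strong_limitMl.
        apply: (strong_limit_vN vB h); apply: nearW => i; rewrite mulrA.
        by case: (Ju i) => _ _ /(_ b Bb) [].
      have h : strong_limit F (fun i => adj (u i) * (b * u i)) (adj L * (b * L)).
        by apply: strong_limitM => //; exact: strong_limitMl.
      apply: (strong_limit_vN vB h); apply: nearW => i; rewrite mulrA.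
      by case: (Ju i) => _ _ /(_ b Bb) [].
    + move=> b Bb; split.
        have h : strong_limit F (fun i => u i * b * adj v) (L * b * adj v).
          by move=> x; exact: hL.
        apply: (strong_limit_vN vB h); apply: nearW => i.
        by case: (Ju i) => _ _ _ /(_ b Bb) [].
      have h : strong_limit F (fun i => adj (u i) * b * v) (adj L * b * v).
        by move=> x; exact: hL'.
      apply: (strong_limit_vN vB h); apply: nearW => i.
      by case: (Ju i) => _ _ _ /(_ b Bb) [].
  have Lv : extends L v.
    apply: (extends_trans pv (LC (sval a) _)); first by exists a.
    by case: (svalP a).
  exists (exist _ L (conj JL Lv)) => s As; apply/asboolP/LC; by exists s.
exists u; split=> // s Js su.
have sv := extends_trans pv su uv.
by have /asboolP := hu (exist _ s (conj Js sv)) (asboolT su).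
Qed.

Lemma pisom0P u : pisom u -> (u == 0) = (adj u * u == 0).
Proof.
move=> pu; apply/eqP/eqP => [->|h]; first by rewrite mulr0.
exact: adj_mul_eq0.
Qed.

(** Suppose that neither 1 - u^* u nor 1 - u u^* vanishes.  Comparison in B gives
    w with w^* w <= v^* v and w w^* <= 1 - u^* u, and then y with
    y^* y <= v w^* w v^* and y y^* <= 1 - u u^*.  The partial isometry
    t = y v w^* satisfies t t^* = y y^*, and u + t is a proper extension of u. *)
Lemma maximal_extension_full M B v u : is_vN M -> is_factor B -> B `<=` M ->
  groupoid_normaliser M B v -> v != 0 ->
  joint_normaliser M B v u -> extends u v ->
  (forall s, joint_normaliser M B v s -> extends s u -> extends u s) ->
  adj u * u = 1 \/ u * adj u = 1.
Proof.
move=> vM fB BM [/normaliserP[Mv vB1 vB2] pv] v0 [Mu pu Bu Buv] uv max.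
have [vB _ _] := fB; have B1 := vN1 vB.
have Ba b : B b -> B (adj b) by exact: vN_adj.
have mB b c : B b -> B c -> B (b * c) by exact: vNM.
have [/eqP|q1] := eqVneq (adj u * u) 1; first by left; apply/eqP.
have [/eqP|q1'] := eqVneq (u * adj u) 1; first by right; apply/eqP.
exfalso; have pu' := pisom_adj pu.
have Bq : B (1 - adj u * u).
  by apply: vNB => //; have [_] := Bu 1 B1; rewrite mulr1.
have Bq' : B (1 - u * adj u).
  by apply: vNB => //; have [+ _] := Bu 1 B1; rewrite mulr1.
have Be : B (adj v * v) by have := vB2 1 B1; rewrite mulr1.
have proj1 p : p * p = p -> (1 - p) * (1 - p) = 1 - p :> 'B(H).
  by move=> pp; rewrite mulrBr mulr1 mulrBl mul1r pp subrr subr0.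
have q0 : 1 - adj u * u != 0 by rewrite subr_eq0 eq_sym.
have qq : (1 - adj u * u) * (1 - adj u * u) = 1 - adj u * u.
  by apply: proj1; rewrite mulrA pu'.
have e0 : adj v * v != 0 by rewrite -pisom0P.
have ee : adj v * v * (adj v * v) = adj v * v by rewrite mulrA pisom_adj.
have [w [Bw w0 pw qw we]] := factor_pisom fB Bq Be q0 e0 qq ee.
have uw : u * w = 0 by rewrite -qw mulrA mulrBr mulr1 mulrA pu subrr mul0r.
have Bp : B (v * (adj w * w) * adj v) by apply: (vB1); apply: (mB) => //; exact: Ba.
set p := v * (adj w * w) * adj v in Bp.
have pp : p * p = p.
  have -> : p * p = v * (adj w * (w * (adj v * v) * adj w * w)) * adj v.
    by rewrite /p !mulrA.
  by rewrite we pw.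
have p0 : p != 0.
  apply: contra w0 => /eqP p0; have wv : w * adj v = 0.
    by apply: adj_mul_eq0; rewrite adjopM adjopK -p0 /p !mulrA.
  by rewrite -we mulrA wv mul0r.
have q0' : 1 - u * adj u != 0 by rewrite subr_eq0 eq_sym.
have qq' : (1 - u * adj u) * (1 - u * adj u) = 1 - u * adj u.
  by apply: proj1; rewrite mulrA pu.
have [y [By y0 py qy yp]] := factor_pisom fB Bq' Bp q0' p0 qq' pp.
have uy : adj u * y = 0 by rewrite -qy mulrA mulrBr mulr1 mulrA pu' subrr mul0r.
pose t := y * v * adj w.
have adjt : adj t = w * adj v * adj y by rewrite /t !adjopM adjopK !mulrA.
have ut : u * adj t = 0 by rewrite adjt !mulrA uw !mul0r.
have ut' : adj u * t = 0 by rewrite /t !mulrA uy !mul0r.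
have tu : t * adj u = 0.
  by have := congr1 adj ut; rewrite adjopM adjopK adjop0.
have tu' : adj t * u = 0.
  by have := congr1 adj ut'; rewrite adjopM adjopK adjop0.
have tt : t * adj t = y * adj y.
  have -> : t * adj t = y * p * adj y by rewrite adjt /t /p !mulrA.
  by rewrite yp.
have pt : t * adj t * t = t by rewrite tt /t !mulrA py.
have Js : joint_normaliser M B v (u + t).
  split.
  - apply: vND => //; apply: vNM => //; last by apply: vN_adj => //; exact: BM.
    by apply: vNM => //; exact: BM.
  - rewrite /pisom adjopD [(u + t) * _]mulrDl !mulrDr ut tu addr0 add0r !mulrDl.
    rewrite -(mulrA u _ t) ut' -(mulrA t _ u) tu' !mulr0 add0r addr0 pt.
    by rewrite pu.
  - have Ct b : B b -> B (u * b * adj t) /\ B (adj u * b * t).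
      move=> Bb; split.
        have -> : u * b * adj t = u * (b * w) * adj v * adj y by rewrite adjt !mulrA.
        by apply: (mB); [apply: (Buv _ _).1; exact: mB | exact: Ba].
      have -> : adj u * b * t = adj u * (b * y) * v * adj w by rewrite /t !mulrA.
      by apply: (mB); [apply: (Buv _ _).2; exact: mB | exact: Ba].
    move=> b Bb; have [C1 C2] := Ct _ Bb; have [/Ba C1' /Ba C2'] := Ct _ (Ba _ Bb).
    have [D1 D2] := Bu _ Bb; rewrite adjopD !mulrDl !mulrDr; split.
      apply: vND => //; apply: vND => //.
        by move: C1'; rewrite !adjopM !adjopK mulrA.
      have -> : t * b * adj t = y * (v * (adj w * b * w) * adj v) * adj y.
        by rewrite adjt /t !mulrA.
      apply: (mB); last exact: Ba.
      by apply: (mB) => //; apply: (vB1); do 2?apply: (mB) => //; exact: Ba.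
    apply: vND => //; apply: vND => //.
      by move: C2'; rewrite !adjopM !adjopK mulrA.
    have -> : adj t * b * t = w * (adj v * (adj y * b * y) * v) * adj w.
      by rewrite adjt /t !mulrA.
    apply: (mB); last exact: Ba.
    by apply: (mB) => //; apply: (vB2); do 2?apply: (mB) => //; exact: Ba.
  - move=> b Bb; have [C1 C2] := Buv _ Bb; rewrite adjopD !mulrDl.
    split; apply: vND => //.
      have -> : t * b * adj v = y * (v * (adj w * b) * adj v) by rewrite /t !mulrA.
      by apply: (mB) => //; apply: (vB1); apply: (mB) => //; exact: Ba.
    have -> : adj t * b * v = w * (adj v * (adj y * b) * v) by rewrite adjt !mulrA.
    by apply: (mB) => //; apply: (vB2); apply: (mB) => //; exact: Ba.
have su : extends (u + t) u.
  by rewrite /extends adjopD !mulrDl tu tu' !addr0.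
have [h _] := max _ Js su.
move: h; rewrite adjopD mulrDr ut addr0 mulrDl !mulrDr ut tu addr0 add0r.
move/eqP; rewrite eq_sym addrC -subr_eq0 addrK tt => /eqP yy.
by move/negP: y0; apply; apply/eqP; rewrite -py yy mul0r.
Qed.

(** 1 is equivalent to u u^*. *)
Lemma finite_pisom M u : finite_projection M 1 -> is_vN M -> M u ->
  adj u * u = 1 -> u * adj u = 1.
Proof.
move=> [_ _ fM] vM Mu u1; apply: fM.
- by apply: vNM => //; exact: vN_adj.
- by split; [rewrite mulrA -(mulrA u) u1 mulr1|rewrite adjopM adjopK].
- by rewrite /subprojection mul1r.
- by exists u.
Qed.

(** The projection is the support v^* v of v, as u is a unitary extension of v. *)
Lemma groupoid_normaliser_unitary M B v : is_vN M -> finite_projection M 1 ->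
  is_factor B -> B `<=` M -> groupoid_normaliser M B v ->
  exists u e, [/\ unitary_normaliser M B u, B e & v = u * e].
Proof.
move=> vM fM fB BM nv; have [vB _ _] := fB.
have [->|v0] := eqVneq v 0.
  exists 1, 0; rewrite mulr0; split=> //; last exact: vN0.
  split; first exact: vN1.
    by split; rewrite adjop1 mulr1.
  apply/seteqP; split=> [_ [b Bb <-]|b Bb]; first by rewrite adjop1 mulr1 mul1r.
  by exists b => //; rewrite adjop1 mulr1 mul1r.
have [u [Ju uv hu]] := maximal_extension vM vB nv.
have full := maximal_extension_full vM fB BM nv v0 Ju uv hu.
have [Mu pu Bu Buv] := Ju.
have Uu : is_unitary u.
  have Mu' : M (adj u) by exact: vN_adj.
  case: full => u1; split=> //; first exact: (finite_pisom fM vM Mu u1).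
  by have := finite_pisom fM vM Mu'; rewrite adjopK; exact.
have [uu uu'] := Uu.
exists u, (adj v * v); split.
- split=> //; apply/seteqP; split=> [_ [b Bb <-]|b Bb]; first exact: (Bu _ Bb).1.
  exists (adj u * b * u); first exact: (Bu _ Bb).2.
  by rewrite !mulrA uu mul1r -mulrA uu mulr1.
- by have [/normaliserP[_ _ /(_ _ (vN1 vB)) h] _] := nv; rewrite mulr1 in h.
- by have [e _] := uv; rewrite mulrA e; have [_ ->] := nv.
Qed.

Lemma normaliser_sub_vN M B N : is_vN M -> finite_projection M 1 ->
  is_factor B -> B `<=` M -> is_vN N -> unitary_normaliser M B `<=` N ->
  normaliser M B `<=` N.
Proof.
move=> vM fM fB BM vN UN n nn; have [vB _ _] := fB.
have BN : B `<=` N.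
  apply: vN_unitaries => // u Bu [uu uu']; apply: UN; split=> //; first exact: BM.
  apply/seteqP; split=> [_ [b Bb <-]|b Bb].
    by do 2?apply: vNM => //; exact: vN_adj.
  exists (adj u * b * u); first by do 2?apply: vNM => //; exact: vN_adj.
  by rewrite !mulrA uu mul1r -mulrA uu mulr1.
have [v [b [nv Bb ->]]] := normaliser_polar vM vB BM nn.
have [u [e [nu Be ->]]] := groupoid_normaliser_unitary vM fM fB BM nv.
by do 2?apply: vNM => //; [exact: UN|exact: BN|exact: BN].
Qed.

(** * Regularity *)

Lemma vN_generatedS M (S S' : set 'B(H)) : S `<=` S' ->
  vN_generated M S `<=` vN_generated M S'.
Proof. by move=> SS x h N vN NM S'N; apply: h => //; exact: subset_trans SS _. Qed.

Lemma vN_generated_sub M (S : set 'B(H)) : is_vN M -> S `<=` M ->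
  vN_generated M S `<=` M.
Proof. by move=> vM SM x; apply. Qed.

Lemma unitary_sub_groupoid M B :
  unitary_normaliser M B `<=` groupoid_normaliser M B.
Proof.
move=> u [Mu [uu uu'] uB]; split; last by rewrite uu mul1r.
apply/normaliserP; split=> // b Bb; first by rewrite -uB; exists b.
move: Bb; rewrite -{1}uB => -[c Bc <-].
by rewrite !mulrA uu' mul1r -mulrA uu' mulr1.
Qed.

End Extension.

Unset Implicit Arguments.

Theorem corollary3p14 (R : realType) (H : hilbertType R) (B M : set 'B(H))
    (hB : II1_factor B) (hM : II1_factor M) (hBM : B `<=` M) :
  (regular M B <-> groupoid_regular M B) /\
  (groupoid_regular M B <-> unitary_regular M B).
Proof.
have [[vM _ _] [_ fM]] := hM; have [fB _] := hB.
have UG := @unitary_sub_groupoid _ _ M B.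
have GN : groupoid_normaliser M B `<=` normaliser M B by move=> v [].
have NM : normaliser M B `<=` M by move=> n [].
have sub S : S `<=` normaliser M B -> vN_generated M S `<=` M.
  by move=> SN; apply: vN_generated_sub => //; exact: subset_trans SN NM.
have NU : vN_generated M (normaliser M B) `<=` vN_generated M (unitary_normaliser M B).
  move=> x h N vN NsM UN; apply: h => //.
  exact: (normaliser_sub_vN vM fM fB hBM vN UN).
have GNg := vN_generatedS (M := M) GN; have UGg := vN_generatedS (M := M) UG.
have step S S' : S' `<=` normaliser M B ->
    vN_generated M S `<=` vN_generated M S' ->
    vN_generated M S = M -> vN_generated M S' = M.
  by move=> S'N SS' e; apply/seteqP; split; [exact: sub|rewrite -{1}e].
have GU := subset_trans GNg NU.
split; split; apply: step => //.
- exact: subset_trans NU UGg.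
- exact: subset_trans UG GN.
Qed.
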